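(* Let $p,q,r$ be positive integers. A triple $(\mathbf a,\mathbf b,\mathbf c)\in\Lambda_{p,q,r}$ belongs to $\Pi_{p,q,r}$ if and only if the unordered triple of partitions $\{\mathbf a^+,\mathbf b^+,\mathbf c^+\}$ is one of the following: - $\{(1),(1),(1)\}$; - $\{(3^2),(2^3),(2,1,1,1,1)\}$; - $\{(4,2),(2^3),(1^6)\}$; - $\{(m+1,m),(m,m,1),(1^{2m+1})\}$ for some $m\ge 2$; - $\{(m,m),(m,m-1,1),(1^{2m})\}$ for some $m\ge 2$; - $\{(n-1,1),(1^n),(1^n)\}$ for some $n\ge 2$.
   Context: All vector spaces are over a fixed algebraically closed field. A composition is a list $\mathbf a=(a_1,\ldots,a_p)$ of nonnegative integers (zero parts allowed); $|\mathbf a|=a_1+\cdots+a_p$, $\|\mathbf a\|^2=a_1^2+\cdots+a_p^2$, $\ell(\mathbf a)=p$. $\mathbf a^+$ is the partition obtained from $\mathbf a$ by removing all zero parts and rearranging the non-zero parts in weakly decreasing order. $(a^p)$ denotes $(a,\ldots,a)$ with $p$ parts. For $\dim V=|\mathbf a|$, $\mathrm{Fl}_{\mathbf a}(V)$ is the variety of flags $A=(0=A_0\subset A_1\subset\cdots\subset A_p=V)$ with $\dim(A_i/A_{i-1})=a_i$. $\Lambda_{p,q,r}$ is the additive semigroup of triples of compositions $(\mathbf a,\mathbf b,\mathbf c)$ with $(\ell(\mathbf a),\ell(\mathbf b),\ell(\mathbf c))=(p,q,r)$ and $|\mathbf a|=|\mathbf b|=|\mathbf c|$. A triple is of finite type if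 $GL(V)$, acting diagonally, has finitely many orbits in $\mathrm{Fl}_{\mathbf a}(V)\times\mathrm{Fl}_{\mathbf b}(V)\times\mathrm{Fl}_{\mathbf c}(V)$, $\dim V=|\mathbf a|$. The Tits form is $Q(\mathbf a,\mathbf b,\mathbf c)=\dim GL(V)-\dim\mathrm{Fl}_{\mathbf a}(V)-\dim\mathrm{Fl}_{\mathbf b}(V)-\dim\mathrm{Fl}_{\mathbf c}(V)=\tfrac12(\|\mathbf a\|^2+\|\mathbf b\|^2+\|\mathbf c\|^2-|\mathbf a|^2)$. $\Pi_{p,q,r}$ is the set of all $\mathbf d\in\Lambda_{p,q,r}$ of finite type with $Q(\mathbf d)=1$. *)

(* Defs.v *)
From HB Require Import structures.
From mathcomp Require Import all_boot all_order all_algebra.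
From mathcomp Require Import boolp classical_sets cardinality.

Set Implicit Arguments.
Unset Strict Implicit.
Unset Printing Implicit Defensive.

Import GRing.Theory.
Local Open Scope classical_set_scope.
Local Open Scope ring_scope.

(* A composition with p parts, zero parts allowed, is a [p.-tuple nat]; its
   total |a| is [sumn a]. *)

Definition sqnorm (a : seq nat) : nat := (\sum_(x <- a) x ^ 2)%N.

Definition part_of (a : seq nat) : seq nat :=
  sort geq [seq x <- a | x != 0%N].

Definition comp3 (p q r : nat) : Type :=
  (p.-tuple nat * q.-tuple nat * r.-tuple nat)%type.

Definition Lambda (p q r : nat) : set (comp3 p q r) :=
  [set d : comp3 p q r | sumn d.1.1 = sumn d.1.2 /\ sumn d.1.2 = sumn d.2].

Section Flags.
Variables (K : fieldType) (V : vectType K).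

(* The tuple A lists A_0, A_1, ..., A_p; the condition at i : 'I_p is
   A_i <= A_(i+1) with dim (A_(i+1) / A_i) equal to the part of a of
   (0-based) index i. *)
Definition Fl (p : nat) (a : p.-tuple nat) : set (p.+1.-tuple {vspace V}) :=
  [set A : p.+1.-tuple {vspace V} | [/\ nth 0%VS A 0 = 0%VS, nth 0%VS A p = fullv &
     forall i : 'I_p, (nth 0%VS A i <= nth 0%VS A i.+1)%VS /\
       \dim (nth 0%VS A i.+1) = (\dim (nth 0%VS A i) + tnth a i)%N]].

Definition lfun_act (m : nat) (g : 'End(V)) (A : m.-tuple {vspace V}) :
    m.-tuple {vspace V} :=
  map_tuple (fun U => (g @: U)%VS) A.

Definition flag3 (p q r : nat) : Type :=
  (p.+1.-tuple {vspace V} * q.+1.-tuple {vspace V} *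
   r.+1.-tuple {vspace V})%type.

(* [g : 'End(V)] is always linear, so [bijective g] says that g is in GL(V). *)
Definition GL_orbit (p q r : nat) (F : flag3 p q r) : set (flag3 p q r) :=
  [set G : flag3 p q r | exists2 g : 'End(V), bijective g &
     G = (lfun_act g F.1.1, lfun_act g F.1.2, lfun_act g F.2)].

End Flags.

Arguments Fl {K} V {p} a.

(* The ambient space is V = K^n with n = |a|. *)
Definition finite_type (K : fieldType) (p q r : nat) (d : comp3 p q r) : Prop :=
  let V : vectType K := 'rV[K]_(sumn d.1.1) in
  finite_set [set GL_orbit F |
    F in Fl V d.1.1 `*` Fl V d.1.2 `*` Fl V d.2].

(* With n = |a| = |b| = |c|, dim GL_n = n^2 and
   dim Fl_a = \sum_(i < j) a_i a_j = (n^2 - ||a||^2) / 2, so that this is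
   dim GL_n - dim Fl_a - dim Fl_b - dim Fl_c. *)
Definition tits_form (p q r : nat) (d : comp3 p q r) : rat :=
  ((sqnorm d.1.1)%:R + (sqnorm d.1.2)%:R + (sqnorm d.2)%:R
   - (sumn d.1.1)%:R ^+ 2) / 2%:R.

Definition Pi (K : fieldType) (p q r : nat) : set (comp3 p q r) :=
  [set d : comp3 p q r | [/\ Lambda d, finite_type K d & tits_form d = 1]].

(* Main.v *)
Require Import Defs.
From HB Require Import structures.
From mathcomp Require Import all_boot all_order all_algebra.
From mathcomp Require Import boolp classical_sets cardinality.
From mathcomp Require Import zify.

(** A triple of flags one of which has at most two nonzero parts is a subspace U
    of K^n with two flags B and C, and B and C have a common adapted basis. The
    automorphisms of (B, C) are then the invertible matrices supported on a
    preorder of the basis, and writing U as a kernel or a row space turns the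
    classification into a matrix problem: arbitrary column operations, and row
    operations along the preorder. In each listed case every matrix reduces to
    one with entries 0 and 1, so there are finitely many orbits. The reduction
    uses again a basis adapted to two flags, now those spanned by two chains of
    rows in the small space, and then the diagonal torus of that basis.

    Conversely, a triple that contains (111, 111, 111), (22, 1111, 1111) or
    (33, 222, 111111), the null roots of the affine diagrams E6, E7, E8, has
    infinitely many orbits: each carries a family of pairwise
    Hom-orthogonal triples of flags indexed by K, to which a fixed summand is
    added. Elementary inequalities on sums of squares show that the triples with
    Q = 1 which contain none of the three are the listed ones. *)

(** Two chains of rows can be made monomial at the same time, and the column scalings of the torus
    then normalize one arbitrary further row. The obstacle is a second row outside the two chains.
    In the families with a parameter there is no such row, or the matrix has a single column; in the
    two triples with n = 6 it has two or three columns, few enough for row operations among the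
    leftover rows to finish. The choice between kernel and row space keeps the number of columns
    small.

    For the converse no decomposition theorem is invoked. Only one diagonal entry of a morphism is
    followed: it is 1 on the identity and vanishes between different parameters, so too many
    isomorphic triples would factor an identity matrix through a space of smaller dimension. *)

Set Implicit Arguments.
Unset Strict Implicit.
Unset Printing Implicit Defensive.

Import GRing.Theory.

(** * Coordinate subspaces and adapted bases *)

Section CoordinateSubspaces.
Variable K : fieldType.
Local Open Scope ring_scope.

(** Rectangular, because the same spans are later taken of the rows of the matrix to be reduced,
    which need not be independent. *)
Definition cspace m n (P : pred 'I_m) (M : 'M[K]_(m, n)) :
    {vspace 'rV[K]_n} := (\sum_(j | P j) <[row j M]>)%VS.

Lemma cspaceP m n (P : pred 'I_m) (M : 'M[K]_(m, n)) v :
  reflect (exists2 c : 'rV[K]_m, (forall j, ~~ P j -> c 0 j = 0) & v = c *m M)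
          (v \in cspace P M).
Proof.
apply: (iffP memv_sumP) => [[vs vsP ->]|[c c0 ->]].
  have cP j : exists c, P j -> vs j = c *: row j M.
    case: (boolP (P j)) => Pj; last by exists 0.
    by have /vlineP[c ->] := vsP j Pj; exists c.
  have [c {}cP] := fin_all_exists cP.
  exists (\row_j if P j then c j else 0) => [j /negPf Pj|]; first by rewrite mxE Pj.
  rewrite mulmx_sum_row [RHS](bigID P) /= [X in _ + X]big1 ?addr0.
    by apply: eq_bigr => j Pj; rewrite mxE Pj cP.
  by move=> j /negPf Pj; rewrite mxE Pj scale0r.
exists (fun j => c 0 j *: row j M) => [j _|]; first by rewrite memvZ ?memv_line.
rewrite mulmx_sum_row (bigID P) /= [X in _ + X]big1 ?addr0 //.
by move=> j /c0 ->; rewrite scale0r.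
Qed.

Lemma eq_cspace m n (P P' : pred 'I_m) (M : 'M[K]_(m, n)) :
  P =1 P' -> cspace P M = cspace P' M.
Proof. by move=> eqP; apply: eq_bigl. Qed.

Lemma cspaceS m n (P P' : pred 'I_m) (M : 'M[K]_(m, n)) :
  subpred P P' -> (cspace P M <= cspace P' M)%VS.
Proof.
move=> sPP'; apply/subvP => v /cspaceP[c c0 ->]; apply/cspaceP; exists c => // j.
by move=> /(contra (sPP' j))/c0.
Qed.

Lemma cspace0 m n (M : 'M[K]_(m, n)) : cspace pred0 M = 0%VS.
Proof. exact: big_pred0_eq. Qed.

Section Basis.
Variable n : nat.
Implicit Types (P : pred 'I_n) (M : 'M[K]_n) (v : 'rV[K]_n).

Lemma mem_cspace P M v : M \in unitmx ->
  reflect (forall j, ~~ P j -> (v *m invmx M) 0 j = 0) (v \in cspace P M).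
Proof.
move=> uM; apply: (iffP (cspaceP _ _ _)) => [[c c0 ->] j /c0|H].
  by rewrite mulmxK.
by exists (v *m invmx M); rewrite ?mulmxKV.
Qed.

Lemma cspaceT M : M \in unitmx -> cspace predT M = fullv.
Proof.
by move=> uM; apply/vspaceP => v; rewrite memvf; apply/(mem_cspace _ _ uM).
Qed.

(** The upper bound is clear. Applied to [P] and to its complement, whose spans add up to a space of
    dimension n, it forces equality. *)
Lemma dim_cspace P M : M \in unitmx -> \dim (cspace P M) = #|P|.
Proof.
move=> uM; have le Q : (\dim (cspace Q M) <= #|Q|)%N.
  apply: (leq_trans (dimv_sum_leqif _).1) => /=.
  by rewrite -sum1_card leq_sum // => j _; rewrite dim_vline leq_b1.
apply/eqP; rewrite eqn_leq le /= -(leq_add2r #|predC P|) cardC card_ord.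
have dimT : \dim (cspace P M + cspace (predC P) M)%VS = n.
  rewrite /cspace -(bigID P predT) -[X in \dim X]/(cspace predT M) cspaceT //.
  by rewrite dimvf /dim /= mul1n.
rewrite -{1}dimT (leq_trans (dimv_add_leqif _ _).1) // leq_add2l.
exact: le.
Qed.

Lemma limg_cspace P M (g : 'M[K]_n) :
  (linfun (mulmxr g) @: cspace P M)%VS = cspace P (M *m g).
Proof.
rewrite limg_sum; apply: eq_bigr => j _.
by rewrite limg_line lfunE /= row_mul.
Qed.

(* Row i of h only involves basis vectors of label at most b i: such invertible
   h are the stabilizer of the coordinate flag with labels b. *)
Definition incid (b : 'I_n -> nat) (h : 'M[K]_n) :=
  forall i j, h i j != 0 -> (b j <= b i)%N.

Lemma cspace_incid b h M k : h \in unitmx -> M \in unitmx -> incid b h ->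
  cspace (fun j => b j < k)%N (h *m M) = cspace (fun j => b j < k)%N M.
Proof.
move=> uh uM hb; apply/eqP; rewrite eqEdim !dim_cspace ?unitmx_mul ?uh //.
rewrite leqnn andbT; apply/subvP => _ /cspaceP[c c0 ->].
apply/cspaceP; exists (c *m h); last by rewrite mulmxA.
move=> j jk; rewrite mxE big1 // => i _.
have [ik|/c0 ->] := boolP (b i < k)%N; last by rewrite mul0r.
have [->|/hb ji] := eqVneq (h i j) 0; first by rewrite mulr0.
by case/negP: jk; apply: leq_ltn_trans ik.
Qed.

(** Converse of [cspace_incid], read off row by row: row i of [M] lies in the step of the flag where
    the label [b i] has just entered, so its coordinates in [M'] have labels at most [b i]. *)
Lemma incid_of_cspace b M M' : M' \in unitmx ->
  (forall j, cspace (fun i => b i < (b j).+1)%N M =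
             cspace (fun i => b i < (b j).+1)%N M') -> incid b (M *m invmx M').
Proof.
move=> uM' eqM i j; apply: contraR; rewrite -ltnNge => ij.
have: row i M \in cspace (fun k => b k < (b i).+1)%N M.
  apply/cspaceP; exists (delta_mx 0 i); last by rewrite rowE.
  by move=> k; rewrite mxE eqxx /=; case: eqVneq => [->|//]; rewrite ltnSn.
rewrite eqM => /(mem_cspace _ _ uM')/(_ j).
by rewrite -row_mul mxE => ->//; rewrite -leqNgt.
Qed.

End Basis.

End CoordinateSubspaces.

Section AdaptedBasis.
Variables (K : fieldType) (n q r : nat).
Local Open Scope ring_scope.

(* W i j is a complement of the sum of D i j.+1 and D i.+1 j in D i.+1 j.+1,
   where D i j is the intersection of B i and C j; the union of bases of the
   spaces W i j is adapted to both flags. *)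
Lemma adapted_basis (B C : nat -> {vspace 'rV[K]_n}) :
    B 0%N = 0%VS -> B q = fullv ->
    (forall i, (i < q)%N -> (B i <= B i.+1)%VS) ->
    C 0%N = 0%VS -> C r = fullv ->
    (forall i, (i < r)%N -> (C i <= C i.+1)%VS) ->
  exists (E : 'M[K]_n) (b c : 'I_n -> nat),
  [/\ E \in unitmx, forall j, (b j < q)%N /\ (c j < r)%N,
    forall i, (i <= q)%N -> B i = cspace (fun j => b j < i)%N E &
    forall i, (i <= r)%N -> C i = cspace (fun j => c j < i)%N E].
Proof.
move=> B0 Bq Bm C0 Cr Cm.
pose D i j := (B i :&: C j)%VS.
pose W i j := (D i.+1 j.+1 :\: (D i j.+1 + D i.+1 j))%VS.
have sD i j : (i < q)%N -> (j < r)%N ->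
    (D i j.+1 + D i.+1 j <= D i.+1 j.+1)%VS.
  by move=> iq jr; rewrite subv_add capvS ?Bm //= capvS ?Cm.
have DW i j : (i < q)%N -> (j < r)%N ->
    D i.+1 j.+1 = (W i j + (D i j.+1 + D i.+1 j))%VS.
  by move=> iq jr; rewrite addv_diff (addv_idPl (sD _ _ iq jr)).
(* A second difference of dimensions, since [D i j.+1] and [D i.+1 j] meet in [D i j]; it telescopes
   in [sumdim]. *)
have dimW i j : (i < q)%N -> (j < r)%N -> (\dim (W i j) +
    (\dim (D i j.+1) + \dim (D i.+1 j)) =
    \dim (D i.+1 j.+1) + \dim (D i j))%N.
  move=> iq jr; have DI : (D i j.+1 :&: D i.+1 j = D i j)%VS.
    apply/vspaceP => v; rewrite !memv_cap.
    case vB: (v \in B i) => //=; case vC: (v \in C j); rewrite ?andbF //=.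
    by rewrite (subvP (Bm _ iq)) ?(subvP (Cm _ jr)).
  have := dimv_sum_cap (D i j.+1) (D i.+1 j); rewrite DI.
  have := dimv_cap_compl (D i.+1 j.+1) (D i j.+1 + D i.+1 j)%VS.
  by rewrite (capv_idPr (sD _ _ iq jr)) -/(W i j); lia.
have sumD i j : (i <= q)%N -> (j <= r)%N ->
    (D i j = \sum_(0 <= k < i) \sum_(0 <= l < j) W k l)%VS.
  move=> iq jr; elim: i iq => [|i IHi] iq; first by rewrite /D B0 cap0v big_nil.
  rewrite big_nat_recr //= -IHi ?(ltnW iq) //.
  elim: j jr {IHi} => [|j IHj] jr; first by rewrite /D C0 !capv0 big_nil addv0.
  rewrite DW // IHj ?(ltnW jr) // [in RHS]big_nat_recr //= !addvA.
  rewrite (addvC (W i j)) -[X in (X + _ = _)%VS]addvA (addvC (W i j)) addvA.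
  suff -> : (D i j.+1 + D i j = D i j.+1)%VS by rewrite -!addvA (addvC (W i j)).
  by apply/addv_idPl/capvS => //; apply: Cm.
have sumdim i j : (i <= q)%N -> (j <= r)%N ->
    (\sum_(0 <= k < i) \sum_(0 <= l < j) \dim (W k l) = \dim (D i j))%N.
  move=> iq jr; elim: i iq => [|i IHi] iq.
    by rewrite big_nil /D B0 cap0v dimv0.
  rewrite big_nat_recr //= IHi ?(ltnW iq) //.
  elim: j jr {IHi} => [|j IHj] jr; first by rewrite /D C0 !capv0 big_nil !dimv0.
  by rewrite big_nat_recr //=; have := IHj (ltnW jr); have := dimW i j iq jr; lia.
pose P := [seq (i, j) | i <- index_iota 0 q, j <- index_iota 0 r].
pose L := [seq (ij, w : 'rV[K]_n) | ij <- P, w <- vbasis (W ij.1 ij.2)].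
(* There are exactly n vectors, so it will be enough that they span: independence need not be
   checked. *)
have sizeL : size L = n.
  rewrite -[LHS]sum1_size big_allpairs_dep /=.
  transitivity (\sum_(ij <- P) \dim (W ij.1 ij.2))%N.
    by apply: eq_bigr => ij _; rewrite sum1_size size_tuple.
  by rewrite big_allpairs sumdim // /D Bq Cr capfv dimvf /dim /= mul1n.
have sumL (p : pred (nat * nat)) :
    (\sum_(x <- L | p x.1) <[x.2]> = \sum_(ij <- P | p ij) W ij.1 ij.2)%VS.
  rewrite big_mkcond [RHS]big_mkcond big_allpairs_dep /=.
  apply: eq_bigr => ij _; case: (p ij); last by rewrite big1_eq.
  by rewrite -span_def (span_basis (vbasisP _)).
pose x0 : nat * nat * 'rV[K]_n := (0%N, 0%N, 0).
pose E : 'M[K]_n := \matrix_k (nth x0 L k).2.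
have sumE (p : pred (nat * nat)) : cspace (fun j => p (nth x0 L j).1) E =
    (\sum_(ij <- P | p ij) W ij.1 ij.2)%VS.
  rewrite -sumL (big_nth x0) sizeL big_mkord.
  by apply: eq_bigr => j _; rewrite rowK.
have nthL (j : 'I_n) : ((nth x0 L j).1.1 < q)%N /\ ((nth x0 L j).1.2 < r)%N.
  have /allpairsPdep[ij [w [ijP _ ->]]] : nth x0 L j \in L.
    by rewrite mem_nth ?sizeL.
  case/allpairsP: ijP => -[k l] /= [kq lr -> /=].
  by move: kq lr; rewrite !mem_index_iota.
exists E, (fun j => (nth x0 L j).1.1), (fun j => (nth x0 L j).1.2); split=> //.
- rewrite -row_full_unit -sub1mx; apply/row_subP => i.
  have : row i 1%:M \in (fullv : {vspace 'rV[K]_n}) by rewrite memvf.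
  have -> : fullv = cspace predT E.
    have -> := sumE predT; rewrite big_allpairs -sumD // /D Bq Cr.
    exact/esym/capfv.
  by case/cspaceP => c _ ->; apply: submxMl.
- move=> i iq; have -> := sumE (fun ij => (ij.1 < i)%N).
  have -> : B i = D i r by rewrite /D Cr capvf.
  rewrite sumD // [RHS]big_mkcond big_allpairs /=.
  rewrite (big_nat_widen _ _ q) //= big_mkcond /=; apply: eq_bigr => k _.
  by case: ifP => // _; rewrite big1_eq.
move=> j jr; have -> := sumE (fun ij => (ij.2 < j)%N).
have -> : C j = D q j by rewrite /D Bq capfv.
rewrite sumD // [RHS]big_mkcond big_allpairs /=; apply: eq_bigr => k _.
by rewrite (big_nat_widen _ _ r) //= big_mkcond.
Qed.
End AdaptedBasis.

(** * Orbits and flags of coordinate subspaces *)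

Section Orbits.
Variable K : fieldType.
Local Open Scope classical_set_scope.

Lemma lker0_bij (V : vectType K) (g : 'End(V)) : bijective g -> lker g == 0%VS.
Proof. by move=> /bij_inj g_inj; apply/lker0P. Qed.

Lemma lfun_act_comp (V : vectType K) m (g h : 'End(V)) (A : m.-tuple {vspace V}) :
  lfun_act g (lfun_act h A) = lfun_act (g \o h)%VF A.
Proof.
by apply: val_inj; rewrite /= -map_comp; apply: eq_map => U /=; rewrite limg_comp.
Qed.

Lemma lfun_act1 (V : vectType K) m (A : m.-tuple {vspace V}) :
  lfun_act \1%VF A = A.
Proof.
apply: val_inj; rewrite /= -[RHS]map_id; apply: eq_map => U /=.
by rewrite lim1g.
Qed.

Lemma GL_orbit_refl (V : vectType K) p q r (F : flag3 V p q r) : GL_orbit F F.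
Proof.
exists \1%VF; last by case: F => [[A B] C]; rewrite !lfun_act1.
by exists id => v; rewrite id_lfunE.
Qed.

Lemma GL_orbit_eq (V : vectType K) p q r (F G : flag3 V p q r) :
  GL_orbit F G -> GL_orbit G = GL_orbit F.
Proof.
case=> g bij_g ->; apply/seteqP; split=> _ [h bij_h ->].
  exists (h \o g)%VF; last by rewrite !lfun_act_comp.
  by apply: (eq_bij (bij_comp bij_h bij_g)) => v; rewrite lfunE.
have ker0 := lker0_bij bij_g.
exists (h \o g^-1)%VF.
  have: bijective (g^-1)%VF.
    by exists g; [apply: lker0_lfunVK|apply: lker0_lfunK].
  by move/(bij_comp bij_h) => /eq_bij; apply=> v; rewrite lfunE.
by rewrite !lfun_act_comp -!comp_lfunA lker0_compVf // comp_lfun1r.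
Qed.

(** The dimension is a parameter and not [sumn a] as in [finite_type]: permuting the flags or
    rewriting n leaves the other data alone. *)
Definition finite_orbits n p q r (a : p.-tuple nat) (b : q.-tuple nat)
    (c : r.-tuple nat) :=
  let V : vectType K := 'rV[K]_n in
  finite_set [set GL_orbit F | F in Fl V a `*` Fl V b `*` Fl V c].

Lemma finite_orbitsC12 n p q r (a : p.-tuple nat) (b : q.-tuple nat)
    (c : r.-tuple nat) : finite_orbits n a b c -> finite_orbits n b a c.
Proof.
pose sw (F : flag3 'rV[K]_n p q r) : flag3 'rV[K]_n q p r := (F.1.2, F.1.1, F.2).
move=> /(@finite_image _ (set (flag3 'rV[K]_n q p r)) _ (fun O => sw @` O)).
apply: sub_finite_set.
move=> _ [[[B A] C] [[/= FB FA] FC] <-].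
exists (GL_orbit (A, B, C)); first by exists (A, B, C).
apply/seteqP; split=> [_ [_ [g bg ->] <-]|_ [g bg ->]]; first by exists g.
by exists (lfun_act g A, lfun_act g B, lfun_act g C) => //; exists g.
Qed.

Lemma finite_orbitsC23 n p q r (a : p.-tuple nat) (b : q.-tuple nat)
    (c : r.-tuple nat) : finite_orbits n a b c -> finite_orbits n a c b.
Proof.
pose sw (F : flag3 'rV[K]_n p q r) : flag3 'rV[K]_n p r q := (F.1.1, F.2, F.1.2).
move=> /(@finite_image _ (set (flag3 'rV[K]_n p r q)) _ (fun O => sw @` O)).
apply: sub_finite_set.
move=> _ [[[A C] B] [[/= FA FC] FB] <-].
exists (GL_orbit (A, B, C)); first by exists (A, B, C).
apply/seteqP; split=> [_ [_ [g bg ->] <-]|_ [g bg ->]]; first by exists g.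
by exists (lfun_act g A, lfun_act g B, lfun_act g C) => //; exists g.
Qed.

Lemma Fl_dim n p (a : p.-tuple nat) A i : Fl 'rV[K]_n a A -> i <= p ->
  \dim (nth 0%VS A i) = sumn (take i a).
Proof.
case=> A0 _ FA; elim: i => [|i IHi] ip; first by rewrite A0 dimv0 take0.
have [_ ->] := FA (Ordinal ip).
by rewrite (take_nth 0) ?size_tuple // sumn_rcons IHi 1?ltnW // (tnth_nth 0).
Qed.

Lemma Fl_sub n p (a : p.-tuple nat) A i j : Fl 'rV[K]_n a A -> i <= j <= p ->
  (nth 0%VS A i <= nth 0%VS A j)%VS.
Proof.
case=> A0 _ FA /andP[]; elim: j => [|j IHj]; first by rewrite leqn0 => /eqP->.
rewrite leq_eqVlt ltnS => /predU1P[->//|/IHj sA jp].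
by apply: subv_trans (sA (ltnW jp)) (FA (Ordinal jp)).1.
Qed.

End Orbits.

Section CoordinateFlags.
Variables (K : fieldType) (n : nat).

Definition cflag q (b : 'I_n -> nat) (M : 'M[K]_n) : q.+1.-tuple {vspace 'rV[K]_n} :=
  [tuple cspace (fun j => b j < i) M | i < q.+1].

Lemma nth_cflag q b M i : i <= q ->
  nth 0%VS (cflag q b M) i = cspace (fun j => b j < i) M.
Proof.
move=> iq; rewrite -[i]/(val (Ordinal (iq : i < q.+1))) -tnth_nth.
by rewrite tnth_mktuple.
Qed.

Lemma cflag_act q b M g :
  lfun_act (linfun (mulmxr g)) (cflag q b M) = cflag q b (M *m g).
Proof.
apply: eq_from_tnth => i; rewrite tnth_map !tnth_mktuple.
exact: limg_cspace.
Qed.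

Lemma mulmxr_bij (g : 'M[K]_n) : g \in unitmx ->
  bijective (linfun (mulmxr g : 'rV[K]_n -> 'rV[K]_n)).
Proof.
move=> ug; exists (mulmxr (invmx g)) => v; rewrite lfunE /=; first exact: mulmxK.
exact: mulmxKV.
Qed.

(** Combinatorial form of a coordinate flag of type [b]: [l j] is the step at which the basis vector
    j enters. *)
Definition labels (b : seq nat) (l : 'I_n -> nat) :=
  (forall j, l j < size b) /\
  (forall i, i < size b -> #|[pred j | l j == i]| = nth 0 b i).

Lemma card_label_lt (l : 'I_n -> nat) i :
  #|[pred j | l j < i.+1]| = #|[pred j | l j < i]| + #|[pred j | l j == i]|.
Proof.
rewrite -!sum1_card (bigID (fun j => l j < i)) /=; congr (_ + _).
  by apply: eq_bigl => j; rewrite !inE ltnS; case: ltngtP.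
by apply: eq_bigl => j; rewrite !inE ltnS -leqNgt; case: ltngtP.
Qed.

Lemma Fl_cflag q (b : q.-tuple nat) (l : 'I_n -> nat) M : M \in unitmx ->
  labels b l -> Fl 'rV[K]_n b (cflag q l M).
Proof.
move=> uM [lq lb]; split; rewrite ?nth_cflag //.
- exact: cspace0.
- rewrite -(cspaceT uM); apply: eq_cspace => j.
  by have := lq j; rewrite size_tuple.
- move=> i; rewrite !nth_cflag // 1?ltnW //; split.
    by apply: cspaceS => j /ltnW.
  by rewrite !dim_cspace // card_label_lt lb ?size_tuple // (tnth_nth 0).
Qed.

Lemma Fl_labels q (b : q.-tuple nat) (l : 'I_n -> nat) M B : M \in unitmx ->
  Fl 'rV[K]_n b B -> (forall j, l j < q) ->
  (forall i, i <= q -> nth 0%VS B i = cspace (fun j => l j < i) M) ->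
  labels b l /\ B = cflag q l M.
Proof.
move=> uM FB lq BE; split.
  split=> [j|i]; rewrite size_tuple // => iq.
  apply/eqP; rewrite -(eqn_add2l #|[pred j | l j < i]|) -card_label_lt.
  rewrite -!(dim_cspace _ uM) -!BE ?(ltnW iq) //.
  by case: FB => _ _ /(_ (Ordinal iq)) [_ ->]; rewrite (tnth_nth 0).
apply: val_inj; apply: (@eq_from_nth _ 0%VS) => [|i]; rewrite ?size_tuple // => iq.
by rewrite nth_cflag // BE.
Qed.

End CoordinateFlags.

(** * From a subspace and two flags to a matrix problem *)

Section FiniteTwoStep.
Variable (K : fieldType).
Local Open Scope classical_set_scope.

Lemma dim_limg_bij n (g : 'End('rV[K]_n)) U : bijective g ->
  \dim (g @: U) = \dim U.
Proof. by move=> /lker0_bij/eqP g0; apply: limg_dim_eq; rewrite g0 capv0. Qed.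

Lemma limg_bij_fullv n (g : 'End('rV[K]_n)) : bijective g -> (g @: fullv)%VS = fullv.
Proof.
by move=> bg; apply/eqP; rewrite eqEdim subvf dim_limg_bij /=.
Qed.

(** In a basis adapted to B and C, these two flags are given by their labels, of which there are
    finitely many; the stabilizer of both then moves [U] to one of finitely many subspaces. The
    condition on partial sums says that the first flag has no members besides 0, [U] and the whole
    space. *)
Lemma finite_two_step n p q r (a : p.-tuple nat) (b : q.-tuple nat)
    (c : r.-tuple nat) u (T : finType) (rep : T -> {vspace 'rV[K]_n}) :
    u <= n -> (forall i, i <= p -> sumn (take i a) \in [:: 0; u; n]) ->
    (forall (U : {vspace 'rV[K]_n}) l m, \dim U = u -> labels b l -> labels c m ->
       exists g, [/\ g \in unitmx, incid l g, incid m g &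
         exists t, (linfun (mulmxr g) @: U)%VS = rep t]) ->
  finite_orbits K n a b c.
Proof.
move=> un au repP; pose s i := sumn (take i a).
pose aflag U : p.+1.-tuple {vspace 'rV[K]_n} :=
  [tuple if s i == 0 then 0%VS else if s i == n then fullv else U | i < p.+1].
pose R (t : T * {ffun 'I_n -> 'I_q} * {ffun 'I_n -> 'I_r}) :=
  (aflag (rep t.1.1), cflag q (fun j => t.1.2 j) (1%:M : 'M[K]_n),
   cflag r (fun j => t.2 j) (1%:M : 'M[K]_n)).
have fin : finite_set (range (fun t => GL_orbit (R t))).
  exact: finite_image finite_finset.
apply: sub_finite_set fin => _ [[[A B] C] [[/= FA FB] FC] <-].
have [U [dimU AE]] : exists U, \dim U = u /\ A = aflag U.
  have [U dimU UA] : exists2 U, \dim U = u &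
      forall i, i <= p -> s i = u -> nth 0%VS A i = U.
    have [/existsP[i /eqP si]|/existsPn H] := boolP [exists i : 'I_p.+1, s i == u].
      have ip : i <= p by rewrite -ltnS.
      exists (nth 0%VS A i) => [|j jp sj]; first by rewrite (Fl_dim FA) //.
      apply/eqP; have [ij|ji] := leqP i j.
        rewrite eq_sym eqEdim (Fl_sub FA) ?ij // !(Fl_dim FA) //.
        by rewrite -/(s i) -/(s j) si sj leqnn.
      rewrite eqEdim (Fl_sub FA) ?(ltnW ji) // !(Fl_dim FA) // -/(s i) -/(s j) si sj.
      by rewrite leqnn.
    (* No member of A has dimension u here, so [aflag] never uses [U] and any subspace of that
       dimension will do. *)
    exists (cspace (fun j => j < u) (1%:M : 'M[K]_n)).
      rewrite dim_cspace ?unitmx1 // -sum1_card.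
      by rewrite -(big_ord_widen _ (fun=> 1)) // sum1_card card_ord.
    by move=> i ip si; case/eqP: (H (Ordinal (ip : i < p.+1))).
  exists U; split=> //; apply: val_inj.
  apply: (@eq_from_nth _ 0%VS) => [|i]; rewrite ?size_tuple // => ip.
  rewrite -[i]/(val (Ordinal ip)) -[RHS]tnth_nth tnth_mktuple /=.
  have := Fl_dim FA ip; rewrite -/(s i); have := au i ip; rewrite -/(s i) !inE.
  have [->|s0] := eqVneq (s i) 0; first by move=> _ /eqP; rewrite dimv_eq0 => /eqP.
  have [->|sn] /= := eqVneq (s i) n.
    move=> _ dimA; apply/eqP; rewrite eqEdim subvf dimA.
    by rewrite dimvf /dim /= mul1n.
  by rewrite orbF => /eqP su _; apply: UA.
have /= [B0 Bq _] := FB; have [/= C0 Cr _] := FC.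
have [E [l [m [uE lm BE CE]]]] := adapted_basis B0 Bq
  (fun i ip => Fl_sub FB (introT andP (conj (leqnSn i) ip))) C0 Cr
  (fun i ip => Fl_sub FC (introT andP (conj (leqnSn i) ip))).
have [lb Bl] := Fl_labels uE FB (fun j => (lm j).1) BE.
have [mc Cm] := Fl_labels uE FC (fun j => (lm j).2) CE.
have uE' : invmx E \in unitmx by rewrite unitmx_inv.
have bE := mulmxr_bij uE'; set e := linfun _ in bE.
have dimU' : \dim (e @: U) = u.
  by rewrite dim_limg_bij.
have [g [ug gl gm [t tE]]] := repP _ _ _ dimU' lb mc.
pose l' : {ffun 'I_n -> 'I_q} := [ffun j => Ordinal (lm j).1].
pose m' : {ffun 'I_n -> 'I_r} := [ffun j => Ordinal (lm j).2].
exists (t, l', m') => //; apply: GL_orbit_eq.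
have bg := mulmxr_bij ug; set f := linfun _ in bg tE.
exists (f \o e)%VF.
  by apply: (eq_bij (bij_comp bg bE)) => v; rewrite lfunE.
rewrite /= -!lfun_act_comp; congr (_, _, _).
- rewrite AE; apply: eq_from_tnth => i; rewrite !tnth_map !tnth_ord_tuple.
  case: ifP => _; first by rewrite !limg0.
  by case: ifP => _; rewrite ?limg_bij_fullv.
- rewrite Bl !cflag_act mulmxV // mul1mx.
  have -> : cflag q l g = cflag q l 1%:M.
    by apply: eq_from_tnth => i; rewrite !tnth_mktuple -{1}[g]mulmx1 cspace_incid ?unitmx1.
  by apply: eq_from_tnth => i; rewrite !tnth_mktuple; apply: eq_cspace => j; rewrite ffunE.
- rewrite Cm !cflag_act mulmxV // mul1mx.
  have -> : cflag r m g = cflag r m 1%:M.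
    by apply: eq_from_tnth => i; rewrite !tnth_mktuple -{1}[g]mulmx1 cspace_incid ?unitmx1.
  by apply: eq_from_tnth => i; rewrite !tnth_mktuple; apply: eq_cspace => j; rewrite ffunE.
Qed.

Local Open Scope ring_scope.

Definition mx01 m n (X : 'M[bool]_(m, n)) : 'M[K]_(m, n) := map_mx (fun b : bool => b%:R) X.

(** The convention is that [R j i] allows multiples of row j to be added to row i. *)
Definition reducible01 n u (R : rel 'I_n) := forall N : 'M[K]_(n, u),
  exists h g X, [/\ h \in unitmx, g \in unitmx,
    forall i j, h i j != 0 -> R j i & h *m N *m g = mx01 X].

(** A matrix [h] supported as in [reducible01] on this relation is [incid] for both labels. *)
Definition label_rel n (l m : 'I_n -> nat) : rel 'I_n :=
  fun i j => (l i <= l j)%N && (m i <= m j)%N.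

(** [U] is the kernel of a matrix with n - u columns: left multiplication by [h] changes the basis
    of the ambient space, right multiplication by [g] the system of equations. *)
Lemma finite_orbits_ker n p q r (a : p.-tuple nat) (b : q.-tuple nat)
    (c : r.-tuple nat) u : (u <= n)%N ->
    (forall i, (i <= p)%N -> sumn (take i a) \in [:: 0; u; n]%N) ->
    (forall l m : 'I_n -> nat, labels b l -> labels c m ->
       reducible01 (n - u) (label_rel l m)) ->
  finite_orbits K n a b c.
Proof.
move=> un au red.
apply: (finite_two_step (rep := fun X : 'M[bool]_(n, n - u) =>
  lker (linfun (mulmxr (mx01 X))) : {vspace 'rV[K]_n}) un au).
move=> U l m dimU lb mc.
have [M [P [uM cardP UE]]] : exists M : 'M[K]_n, exists P : pred 'I_n,
    [/\ M \in unitmx, #|P| = u & U = cspace P M].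
  pose B (i : nat) : {vspace 'rV[K]_n} :=
    if i is i'.+1 then if i' is 0%N then U else fullv else 0%VS.
  have BS i : (i < 2)%N -> (B i <= B i.+1)%VS.
    by case: i => [|[]] //= _; rewrite ?sub0v ?subvf.
  have [M [k [_ [uM _ kE _]]]] := @adapted_basis _ _ 2 2 B B erefl erefl BS erefl erefl BS.
  exists M, (fun j => k j < 1)%N; split=> //; last by rewrite -(kE 1%N).
  by rewrite -(dim_cspace _ uM) -(kE 1%N).
have cardPC : #|predC P| = (n - u)%N by rewrite -[n in RHS]card_ord -(cardC P) cardP addKn.
(* The columns of [N] compute the coordinates outside [P] in the basis [M], and these vanish exactly
   on [U]. *)
pose N : 'M[K]_(n, n - u) :=
  \matrix_(i, j) invmx M i (enum_val (cast_ord (esym cardPC) j)).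
have UN v : (v \in U) = (v *m N == 0).
  apply/idP/eqP => [vU|vN].
    apply/rowP => j; have Pj := enum_valP (cast_ord (esym cardPC) j).
    move: vU; rewrite UE => /(mem_cspace _ _ uM)/(_ _ Pj) vj.
    rewrite mxE [RHS]mxE -[RHS]vj mxE.
    by apply: eq_bigr => i _; rewrite mxE.
  rewrite UE; apply/(mem_cspace _ _ uM) => j Pj.
  have jP : j \in predC P by [].
  have := congr1 (fun w : 'rV_(n - u) => w 0 (cast_ord cardPC (enum_rank_in jP j))) vN.
  rewrite mxE [RHS]mxE => vj; rewrite -[RHS]vj mxE; apply: eq_bigr => i _.
  by rewrite mxE cast_ordK enum_rankK_in.
have [h [g [X [uh ug hR hN]]]] := red l m lb mc N.
have uh' : invmx h \in unitmx by rewrite unitmx_inv.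
(* The inverse of [h] fixes the coordinate flag because [h] does. *)
have incidV (k : 'I_n -> nat) : (forall i j, h i j != 0%R -> k j <= k i)%N ->
    incid k (invmx h).
  move=> hk; have kP : forall i, cspace (fun j => k j < i)%N (1%:M : 'M[K]_n) =
      cspace (fun j => k j < i)%N h.
    by move=> i; rewrite -[h in RHS]mulmx1 cspace_incid ?unitmx1.
  by rewrite -[invmx h]mul1mx; apply: incid_of_cspace => // j; apply: kP.
exists (invmx h); split=> //.
- by apply: incidV => i j /hR/andP[].
- by apply: incidV => i j /hR/andP[].
exists X; apply/vspaceP => v; rewrite memv_ker lfunE /= -hN.
have -> : (v \in linfun (mulmxr (invmx h)) @: U)%VS = (v *m h \in U).
  apply/idP/idP => [/memv_imgP[w wU ->]|vhU]; first by rewrite lfunE /= mulmxKV.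
  by apply/memv_imgP; exists (v *m h); rewrite // lfunE /= mulmxK.
rewrite UN !mulmxA; apply/eqP/eqP => [->|]; first by rewrite mul0mx.
by move/(congr1 (mulmx^~ (invmx g))); rewrite mulmxK // mul0mx.
Qed.

(** [U] is now the row space of a matrix with u rows, and its transpose is reduced. The ambient
    change of basis is [h^T], which is why the relation is reversed. *)
Lemma finite_orbits_span n p q r (a : p.-tuple nat) (b : q.-tuple nat)
    (c : r.-tuple nat) u : (u <= n)%N ->
    (forall i, (i <= p)%N -> sumn (take i a) \in [:: 0; u; n]%N) ->
    (forall l m : 'I_n -> nat, labels b l -> labels c m ->
       reducible01 u (fun i j => label_rel l m j i)) ->
  finite_orbits K n a b c.
Proof.
move=> un au red.
apply: (finite_two_step (rep := fun X : 'M[bool]_(n, u) =>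
  limg (linfun (mulmxr (mx01 X)^T : 'rV[K]_u -> 'rV[K]_n))) un au).
move=> U l m dimU lb mc; subst u.
pose M : 'M[K]_(\dim U, n) := \matrix_i (vbasis U)`_i.
have UM : U = limg (linfun (mulmxr M : 'rV[K]_(\dim U) -> 'rV[K]_n)).
  apply/vspaceP => v; apply/idP/memv_imgP => [/coord_vbasis ->|[w _ ->]].
    exists (\row_i coord (vbasis U) i v); rewrite ?memvf // lfunE /=.
    by rewrite mulmx_sum_row; apply: eq_bigr => i _; rewrite mxE rowK.
  rewrite lfunE /= mulmx_sum_row; apply: memv_suml => i _; apply: memvZ.
  by rewrite rowK vbasis_mem // mem_nth // size_tuple.
have [h [g [X [uh ug hR hN]]]] := red l m lb mc M^T.
exists h^T; split; rewrite ?unitmx_tr //.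
- by move=> i j; rewrite mxE => /hR/andP[].
- by move=> i j; rewrite mxE => /hR/andP[].
exists X; rewrite {1}UM -hN !trmx_mul trmxK; apply/vspaceP => v.
apply/memv_imgP/memv_imgP => [[_ /memv_imgP[w _ ->] ->]|[w _ ->]].
  exists (w *m invmx g^T); first exact: memvf.
  by rewrite !lfunE /= !mulmxA mulmxKV ?unitmx_tr.
exists (w *m g^T *m M); last by rewrite !lfunE /= !mulmxA.
by apply/memv_imgP; exists (w *m g^T); rewrite ?memvf // lfunE.
Qed.

End FiniteTwoStep.

(** * The matrix problem *)

Section RowReduction.
Variables (K : fieldType) (n u : nat) (R : rel 'I_n).
Hypotheses (Rrefl : reflexive R) (Rtrans : transitive R).
Implicit Types (N : 'M[K]_(n, u)) (S : pred 'I_n) (k : 'I_n -> nat).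
Local Open Scope ring_scope.

Definition row_equiv N N' := exists (h : 'M[K]_n) (g : 'M[K]_u),
  [/\ h \in unitmx, g \in unitmx, forall i j, h i j != 0 -> R j i &
      N' = h *m N *m g].

Lemma row_equiv_trans N1 N2 N3 :
  row_equiv N1 N2 -> row_equiv N2 N3 -> row_equiv N1 N3.
Proof.
move=> [h1 [g1 [uh1 ug1 hR1 ->]]] [h2 [g2 [uh2 ug2 hR2 ->]]].
exists (h2 *m h1), (g1 *m g2); rewrite !unitmx_mul uh1 uh2 ug1 ug2.
split=> // [i j|]; last by rewrite !mulmxA.
rewrite mxE => /eqP hij; apply/negPn/negP => /negPf Rji; case: hij.
apply: big1 => l _; have [->|/hR2 Rli] := eqVneq (h2 i l) 0; first by rewrite mul0r.
have [->|/hR1 Rjl] := eqVneq (h1 l j) 0; first by rewrite mulr0.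
by rewrite (Rtrans Rjl Rli) in Rji.
Qed.

(** A row vector killed by [h] vanishes entry by entry, starting from the indices where [k] is
    largest. *)
Lemma triangular_unit (h : 'M[K]_n) k : (forall i, h i i != 0) ->
  (forall i j, h i j != 0 -> i = j \/ (k j < k i)%N) -> h \in unitmx.
Proof.
move=> hd ht; rewrite -row_free_unit -kermx_eq0; apply/rowV0P => v.
rewrite sub_kermx => /eqP vh; apply/rowP => j; rewrite mxE.
suff H L : forall j, (\max_i k i - k j < L)%N -> v 0 j = 0 by exact: H.
elim: L => [//|L IHL] {}j jL.
have := congr1 (fun w : 'rV_n => w 0 j) vh; rewrite !mxE (bigD1 j) //= big1.
  by rewrite addr0 => /eqP; rewrite mulf_eq0 (negPf (hd j)) orbF => /eqP.
move=> i ij; have [->|/ht] := eqVneq (h i j) 0; first by rewrite mulr0.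
case=> [ijE|kji]; first by rewrite ijE eqxx in ij.
by rewrite IHL ?mul0r //; have := leq_bigmax (F := k) i; lia.
Qed.

Lemma row_equiv_tri N N' (h : 'M[K]_n) (g : 'M[K]_u) k : g \in unitmx ->
    (forall i, h i i != 0) ->
    (forall i j, h i j != 0 -> i = j \/ R j i /\ (k j < k i)%N) ->
  N' = h *m N *m g -> row_equiv N N'.
Proof.
move=> ug hd hR ->; exists h, g; split=> //.
- by apply: (triangular_unit (k := k)) => // i j /hR[|[]]; [left|right].
- by move=> i j /hR[->|[]].
Qed.

Lemma row_equiv_row N N' i (c : K) (w : 'I_n -> K) : c != 0 ->
    (forall j, w j != 0 -> R j i && (j != i)) ->
    row i N' = c *: row i N + \sum_j w j *: row j N ->
    (forall j, j != i -> row j N' = row j N) -> row_equiv N N'.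
Proof.
move=> c0 wR Ni Nj.
pose h : 'M[K]_n := \matrix_(a, b) if a == i then c *+ (b == i) + w b else (a == b)%:R.
have wi : w i = 0 by apply/eqP/negPn/negP => /wR; rewrite eqxx andbF.
(* The key is 1 at i and 0 elsewhere, because only row i receives other rows. *)
apply: (@row_equiv_tri N N' h 1%:M (fun a => (a == i) : nat)).
- exact: unitmx1.
- move=> a; rewrite mxE; have [->|ai] := eqVneq a i; last by rewrite eqxx oner_neq0.
  by rewrite wi addr0.
- move=> a b; rewrite mxE; have [->|ai] := eqVneq a i.
    have [->|bi] := eqVneq b i; first by left.
    by rewrite mulr0n add0r => /wR/andP[Rb _]; right.
  by have [->|] := eqVneq a b; [left|rewrite eqxx].
rewrite mulmx1; apply/row_matrixP => a; rewrite row_mul.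
case: (eqVneq a i) => [->|ai].
  rewrite Ni mulmx_sum_row; under [in RHS]eq_bigr => b _ do rewrite !mxE eqxx scalerDl.
  rewrite big_split; congr (_ + _).
  rewrite (bigD1 i) //= eqxx big1 ?addr0 // => b /negPf->.
  by rewrite scale0r.
rewrite (Nj a ai); suff -> : row a h = delta_mx 0 a by rewrite -rowE.
by apply/rowP => b; rewrite !mxE (negPf ai) eqxx eq_sym.
Qed.

(** By injectivity of [k], row j alone is new at step [k j]. If a vector of [E] has that label, it
    is a combination of the rows so far in which row j must occur, as it is not in the earlier span.
    If none has, the span does not grow and earlier rows clear row j. *)
Lemma chain_row N S k (E : 'M[K]_u) (b : 'I_u -> nat) j : injective k ->
    E \in unitmx -> S j ->
    (forall i, (i <= (k j).+1)%N ->
      cspace (fun l => S l && (k l < i)%N) N = cspace (fun e => b e < i)%N E) ->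
  exists w : 'rV[K]_n, [/\ w 0 j != 0,
    forall l, w 0 l != 0 -> j = l \/ S l /\ (k l < k j)%N &
    w *m N = 0 \/ exists e, w *m N = row e E].
Proof.
move=> kinj uE Sj NE.
have sub l : S l && (k l < (k j).+1)%N -> l != j -> S l && (k l < k j)%N.
  by case/andP=> -> /= kl lj; rewrite ltn_neqAle -ltnS kl (inj_eq kinj) lj.
have [/existsP[e /eqP be]|/existsPn nobk] := boolP [exists e, b e == k j].
  have: row e E \in cspace (fun e => b e < (k j).+1)%N E.
    apply/cspaceP; exists (delta_mx 0 e); last by rewrite rowE.
    by move=> e'; rewrite mxE eqxx /=; case: eqVneq => // ->; rewrite be ltnSn.
  rewrite -NE // => /cspaceP[w w0 Ew]; exists w; split; last by right; exists e.
    apply/negP => /eqP wj.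
    have: row e E \in cspace (fun e => b e < k j)%N E.
      rewrite -NE //; apply/cspaceP; exists w => // l.
      have [->//|lj] := eqVneq l j; move=> Sl; apply: w0; apply: contra Sl.
      by move=> /sub; apply.
    move=> /(mem_cspace _ _ uE)/(_ e); rewrite be ltnn => /(_ isT)/eqP.
    by rewrite -row_mul mulmxV // row1 mxE !eqxx oner_eq0.
  move=> l; have [->|lj] := eqVneq l j; first by left.
  move=> wl; right; apply/andP/sub => //; apply: contraNT wl => /w0 ->.
  by rewrite eqxx.
have: row j N \in cspace (fun l => S l && (k l < (k j).+1)%N) N.
  apply/cspaceP; exists (delta_mx 0 j); last by rewrite rowE.
  by move=> l; rewrite mxE eqxx /=; case: eqVneq => // ->; rewrite Sj ltnSn.
rewrite NE //.
have -> : cspace (fun e => b e < (k j).+1)%N E = cspace (fun e => b e < k j)%N E.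
  by apply: eq_cspace => e; rewrite ltnS leq_eqVlt (negPf (nobk e)).
rewrite -NE // => /cspaceP[w w0 jw].
have wj : w 0 j = 0 by apply: w0; rewrite ltnn andbF.
exists (delta_mx 0 j - w); split.
- by rewrite !mxE !eqxx wj subr0 oner_neq0.
- move=> l; rewrite !mxE eqxx /=; have [->|lj] := eqVneq l j; first by left.
  rewrite sub0r oppr_eq0 => wl; right; apply/andP; apply: contraNT wl => /w0->.
  by rewrite eqxx.
by left; rewrite mulmxBl -rowE jw subrr.
Qed.

Definition monomial_row (v : 'rV[K]_u) := v = 0 \/ exists e, v = delta_mx 0 e.

Definition chain k S := forall i j, S i -> S j -> (k i <= k j)%N -> R i j.

(* Two chains of rows span two flags of row spaces, for which there is a common
   adapted basis. *)
Lemma two_chains N S1 S2 k : injective k -> chain k S1 -> chain k S2 ->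
  (forall i, ~~ (S1 i && S2 i)) ->
  exists (N' : 'M[K]_(n, u)) (g : 'M[K]_u), [/\ row_equiv N N', g \in unitmx,
    forall i, S1 i || S2 i -> monomial_row (row i N') &
    forall i, ~~ (S1 i || S2 i) -> row i N' = row i N *m g].
Proof.
move=> kinj ch1 ch2 S12; pose L := (\max_i k i).+1.
have kL i : (k i < L)%N by rewrite ltnS leq_bigmax.
(* The rows of [S] need not span, so one extra step [L.+1] brings the flag to the whole space. *)
pose B S i : {vspace 'rV[K]_u} :=
  if (i <= L)%N then cspace (fun l => S l && (k l < i)%N) N else fullv.
have B0 S : B S 0%N = 0%VS.
  by rewrite /B /= -(cspace0 N); apply: eq_cspace => l; rewrite andbF.
have Bq S : B S L.+1 = fullv by rewrite /B ltnn.
have BS S i : (i < L.+1)%N -> (B S i <= B S i.+1)%VS.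
  rewrite /B ltnS => -> /=; case: ifP => _; last exact: subvf.
  by apply: cspaceS => l /andP[-> /ltnW]; rewrite ltnS.
have [E [b [c [uE _ bE cE]]]] :=
  adapted_basis (B0 S1) (Bq S1) (BS S1) (B0 S2) (Bq S2) (BS S2).
have rowS i : exists w : 'rV[K]_n, [/\ w 0 i != 0,
    forall l, w 0 l != 0 -> i = l \/ R l i /\ (k l < k i)%N,
    S1 i || S2 i -> w *m N = 0 \/ exists e, w *m N = row e E &
    ~~ (S1 i || S2 i) -> w = delta_mx 0 i].
  have chainS S d : (forall i, (i <= L.+1)%N -> B S i = cspace (fun j => d j < i)%N E) ->
      chain k S -> S i -> exists w : 'rV[K]_n, [/\ w 0 i != 0,
        forall l, w 0 l != 0 -> i = l \/ R l i /\ (k l < k i)%N &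
        w *m N = 0 \/ exists e, w *m N = row e E].
    move=> dE chS Si; case: (@chain_row N S k E d i kinj uE Si).
      move=> j jk; have jL : (j <= L)%N by apply: leq_trans jk _.
      by rewrite -dE ?(leqW jL) // /B jL.
    move=> w [wi wl wN]; exists w; split=> // l /wl[|[Sl kl]]; [by left|right].
    by split=> //; apply: chS => //; apply: ltnW.
  case S1i: (S1 i).
    by have [w [wi wl wN]] := chainS _ _ bE ch1 S1i; exists w.
  case S2i: (S2 i).
    by have [w [wi wl wN]] := chainS _ _ cE ch2 S2i; exists w.
  exists (delta_mx 0 i); split=> //; first by rewrite mxE !eqxx oner_neq0.
  by move=> l; rewrite mxE eqxx /=; have [->|] := eqVneq l i; [left|rewrite eqxx].
have [w wP] := fin_all_exists rowS.
(* [h] collects the combinations, and the column operation [invmx E] turns the vectors of [E] into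
   unit vectors. *)
pose h : 'M[K]_n := \matrix_i w i.
have hE i j : h i j = w i 0 j by rewrite mxE.
have uE' : invmx E \in unitmx by rewrite unitmx_inv.
exists (h *m N *m invmx E), (invmx E); split=> //.
- apply: (@row_equiv_tri _ _ h (invmx E) k) => //.
    by move=> i; rewrite hE; case: (wP i).
  by move=> i j; rewrite hE; case: (wP i) => _ /(_ j).
- move=> i Si; rewrite !row_mul rowK; case: (wP i) => _ _ /(_ Si)[->|[e ->]] _.
    by left; rewrite mul0mx.
  by right; exists e; rewrite -row_mul mulmxV // row1.
- by move=> i Si; rewrite !row_mul rowK; case: (wP i) => _ _ _ /(_ Si)->; rewrite -rowE.
Qed.

End RowReduction.

(** * Normalization by the diagonal torus *)

Section TorusReduction.
Variables (K : fieldType) (n u : nat) (R : rel 'I_n).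
Hypotheses (Rrefl : reflexive R) (Rtrans : transitive R).
Implicit Types (N : 'M[K]_(n, u)) (S : pred 'I_n) (k : 'I_n -> nat).
Implicit Types (v : 'rV[K]_u) (d : 'rV[K]_u).
Local Open Scope ring_scope.

Definition is01 v := forall e, v 0 e = 0 \/ v 0 e = 1.

Definition reduces01 N := exists2 N', row_equiv R N N' & forall i, is01 (row i N').

Lemma reduces01_trans N N' : row_equiv R N N' -> reduces01 N' -> reduces01 N.
Proof. by move=> NN' [N'' /(row_equiv_trans Rtrans NN')]; exists N''. Qed.

Lemma reducible01P : (forall N, reduces01 N) -> reducible01 K u R.
Proof.
move=> red N; have [_ [h [g [uh ug hR ->]]] N01] := red N.
exists h, g, (\matrix_(i, j) ((h *m N *m g) i j == 1)); split=> //.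
apply/matrixP => i j; rewrite !mxE; have := N01 i j; rewrite !mxE => -[]->.
  by rewrite eq_sym oner_eq0.
by rewrite eqxx.
Qed.

(** The column scaling [d] is common to all rows, while the factor [c] is each row's own. *)
Definition scalable01 d v := exists2 c : K, c != 0 & is01 (c *: (v *m diag_mx d)).

Lemma scalable01_single d v e : (forall e, d 0 e != 0) ->
  (forall e', e' != e -> v 0 e' = 0) -> scalable01 d v.
Proof.
move=> d0 ve; have [v0|v0] := eqVneq (v 0 e) 0.
  exists 1; first exact: oner_neq0.
  move=> e'; left; rewrite scale1r mul_mx_diag mxE.
  by have [->|/ve->] := eqVneq e' e; rewrite ?v0 mul0r.
exists (v 0 e * d 0 e)^-1; first by rewrite invr_neq0 // mulf_neq0.
move=> e'; rewrite mul_mx_diag !mxE; have [->|/ve->] := eqVneq e' e.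
  by right; rewrite mulVf // mulf_neq0.
by left; rewrite mul0r mulr0.
Qed.

Lemma scalable01_exists v : exists2 d : 'rV[K]_u, forall e, d 0 e != 0 & scalable01 d v.
Proof.
exists (\row_e if v 0 e == 0 then 1 else (v 0 e)^-1).
  by move=> e; rewrite mxE; case: ifPn => [_|/invr_neq0 //]; apply: oner_neq0.
exists 1; first exact: oner_neq0.
move=> e; rewrite scale1r mul_mx_diag !mxE; case: ifPn => [/eqP->|v0].
  by left; rewrite mul0r.
by right; rewrite mulfV.
Qed.

Lemma monomial_scalable01 d v : (forall e, d 0 e != 0) -> monomial_row v ->
  scalable01 d v.
Proof.
move=> d0 [->|[e ->]].
  exists 1; first exact: oner_neq0.
  by move=> e; left; rewrite mul0mx scaler0 mxE.
by apply: (scalable01_single (e := e)) => // e' /negPf ne; rewrite mxE ne andbF.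
Qed.

Lemma torus01 N d : (forall e, d 0 e != 0) ->
  (forall i, scalable01 d (row i N)) -> reduces01 N.
Proof.
move=> d0 scN; have scN' i : exists c : K, c != 0 /\ is01 (c *: (row i N *m diag_mx d)).
  by have [c] := scN i; exists c.
have [c cP] := fin_all_exists scN'.
exists (diag_mx (\row_i c i) *m N *m diag_mx d).
  exists (diag_mx (\row_i c i)), (diag_mx d); split=> //.
  - rewrite unitmxE det_diag unitfE; apply/prodf_neq0 => i _; rewrite mxE.
    by case: (cP i).
  - by rewrite unitmxE det_diag unitfE; apply/prodf_neq0.
  - by move=> i j; rewrite mxE; have [->|] := eqVneq i j; rewrite ?Rrefl // eqxx.
move=> i; have [_] := cP i; congr (is01 _).
by rewrite !row_mul row_diag_mx mxE -!scalemxAl -rowE.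
Qed.

(** Monomial rows accept every [d], so [d] can be dictated by the only row outside the two
    chains. *)
Lemma two_chains_single S1 S2 k : injective k -> chain R k S1 -> chain R k S2 ->
  (forall i, ~~ (S1 i && S2 i)) ->
  (forall i j, ~~ (S1 i || S2 i) -> ~~ (S1 j || S2 j) -> i = j) ->
  reducible01 K u R.
Proof.
move=> kinj ch1 ch2 S12 S12'; apply: reducible01P => N.
have [N' [g [NN' ug mono _]]] := two_chains Rrefl N kinj ch1 ch2 S12.
apply: reduces01_trans NN' _.
have [/existsP[x Sx]|/existsPn S] := boolP [exists x, ~~ (S1 x || S2 x)].
  have [d d0 dx] := scalable01_exists (row x N').
  apply: (torus01 d0) => i; have [Si|Si] := boolP (S1 i || S2 i).
    by apply: monomial_scalable01 => //; apply: mono.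
  by rewrite (S12' i x).
apply: (@torus01 _ (const_mx 1)) => [e|i]; first by rewrite mxE oner_neq0.
apply: monomial_scalable01 => [e|]; first by rewrite mxE oner_neq0.
by apply: mono; have := S i; rewrite negbK.
Qed.

Lemma row_addl N i (w : 'I_n -> K) : (forall j, w j != 0 -> R j i && (j != i)) ->
  exists N', [/\ row_equiv R N N',
    row i N' = row i N + \sum_j w j *: row j N &
    forall j, j != i -> row j N' = row j N].
Proof.
move=> wR; pose N' := \matrix_j
  (row j N + if j == i then \sum_j w j *: row j N else 0).
have Ni : row i N' = row i N + \sum_j w j *: row j N by rewrite rowK eqxx.
have Nj j : j != i -> row j N' = row j N by move=> /negPf ji; rewrite rowK ji addr0.
exists N'; split=> //; apply: (@row_equiv_row _ _ _ _ Rrefl _ _ i 1 w) => //.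
  exact: oner_neq0.
by rewrite scale1r.
Qed.

End TorusReduction.

Section SmallDimension.
Variables (K : fieldType) (n : nat) (R : rel 'I_n).
Hypotheses (Rrefl : reflexive R) (Rtrans : transitive R).
Implicit Types (S : pred 'I_n) (k : 'I_n -> nat).
Local Open Scope ring_scope.

Lemma ord2_other (a : 'I_2) : exists c : 'I_2, forall e, e != a -> e = c.
Proof.
exists (inord (1 - a)) => e ea; apply: val_inj; rewrite /= inordK; last by lia.
by move: ea; rewrite -val_eqE /=; have := ltn_ord e; have := ltn_ord a; lia.
Qed.

Lemma ord3_other (a b : 'I_3) : a != b ->
  exists c : 'I_3, forall e, e != a -> e != b -> e = c.
Proof.
rewrite -val_eqE /= => ab; exists (inord (3 - (a + b))) => e.
have := ltn_ord e; have := ltn_ord a; have := ltn_ord b.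
rewrite -!val_eqE /= => b3 a3 e3 ea eb; apply: val_inj; rewrite /= inordK; lia.
Qed.

(** If row x is nonzero, it clears an entry of row y, which keeps at most one and so accepts every
    [d]; then x dictates [d]. If row x is zero, y does. *)
Lemma three_chains_dim2 S1 S2 x y k : injective k -> chain R k S1 -> chain R k S2 ->
  (forall i, ~~ (S1 i && S2 i)) -> (forall i, ~~ (S1 i || S2 i) -> i = x \/ i = y) ->
  ~~ (S1 y || S2 y) -> x != y -> R x y -> reducible01 K 2 R.
Proof.
move=> kinj ch1 ch2 S12 Sxy Sy xy Rxy; apply: reducible01P => N0.
have [N [g [N0N ug mono _]]] := two_chains Rrefl N0 kinj ch1 ch2 S12.
apply: reduces01_trans N0N _ => //.
have [x0|/rV0Pn[a xa]] := eqVneq (row x N) 0.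
  have [d d0 dy] := scalable01_exists (row y N).
  apply: (torus01 _ d0) => // i; have [Si|/Sxy[->|-> //]] := boolP (S1 i || S2 i).
    by apply: monomial_scalable01 => //; apply: mono.
  by apply: monomial_scalable01 => //; left.
pose w j := if j == x then - (N y a / N x a) else 0.
have [|N' [NN' yN' jN']] := row_addl Rrefl N (i := y) (w := w).
  by move=> j; rewrite /w; have [->|] := eqVneq j x; rewrite ?Rxy ?eqxx.
apply: reduces01_trans NN' _ => //.
have [d d0 dx] := scalable01_exists (row x N).
apply: (torus01 _ d0) => // i; have [Si|/Sxy[->|->]] := boolP (S1 i || S2 i).
- rewrite jN'; first by apply: monomial_scalable01 => //; apply: mono.
  by apply: contraNneq Sy => <-.
- by rewrite jN'.
have [c ca] := ord2_other a; apply: (scalable01_single (e := c)) => // e ec.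
have -> : e = a by apply/eqP; apply: contra_neqT ec => /ca.
rewrite yN' mxE summxE (bigD1 x) //= big1 => [|j /negPf jx].
  by rewrite /w eqxx addr0 !mxE mulNr mulfVK ?subrr //; move: xa; rewrite mxE.
by rewrite /w jx scale0r mxE.
Qed.

(** Make [S] and {z, t} monomial. If row z is zero, use [S] and {x, y} instead: t is the only other
    nonzero row and dictates [d]. If row z is the unit vector at a, either x lives in column a and y
    dictates [d], or x and z together clear two of the three entries of y and x dictates [d]. *)
Lemma linked_chains_dim3 S z t x y k : injective k -> chain R k S ->
    chain R k (pred2 z t) -> chain R k (pred2 x y) ->
    (forall i, ~~ S i -> [\/ i = z, i = t, i = x | i = y]) ->
    (forall i, S i -> i \notin [:: z; t; x; y]) -> uniq [:: z; t; x; y] ->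
  R x y -> R z y -> reducible01 K 3 R.
Proof.
move=> kinj chS chzt chxy Sout Sin uq Rxy Rzy; apply: reducible01P => N0.
move: uq; rewrite /= !inE !negb_or => /and4P[/and3P[zt zx zy] /andP[tx ty] xy _].
have dis1 i : ~~ (S i && pred2 z t i).
  apply/negP => /= /andP[/Sin]; rewrite !inE !negb_or => /and4P[/negPf-> /negPf->] //.
have dis2 i : ~~ (S i && pred2 x y i).
  apply/negP => /= /andP[/Sin]; rewrite !inE !negb_or => /and4P[_ _ /negPf-> /negPf->] //.
have [N [g [N0N ug mono _]]] := two_chains Rrefl N0 kinj chS chzt dis1.
apply: reduces01_trans N0N _ => //.
have [z0|zN0] := eqVneq (row z N) 0.
  have [N' [g' [NN' ug' mono' zN']]] := two_chains Rrefl N kinj chS chxy dis2.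
  apply: reduces01_trans NN' _ => //.
  have [d d0 dt] := scalable01_exists (row t N').
  have Sz : ~~ S z by apply/negP => /Sin; rewrite inE eqxx.
  apply: (torus01 _ d0) => // i; have [Si|] := boolP (S i || pred2 x y i).
    by apply: monomial_scalable01 => //; apply: mono'.
  rewrite negb_or /= => /andP[/Sout[->|-> //|->|->]]; rewrite ?eqxx ?orbT // => _.
  apply: monomial_scalable01 => //; left; rewrite zN' ?z0 ?mul0mx //.
  by rewrite negb_or Sz /= negb_or zx zy.
have [//|[a za]] : monomial_row (row z N) by apply: mono; rewrite /= eqxx orbT.
  by move=> z0; rewrite z0 eqxx in zN0.
have outxy i : ~~ (S i || pred2 z t i) -> i = x \/ i = y.
  rewrite negb_or /= => /andP[/Sout[->|->|->|->]]; rewrite ?eqxx ?orbT //; by [left|right].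
have [/existsP[b /andP[ba xb]]|/existsPn xa] :=
  boolP [exists b, (b != a) && (N x b != 0)]; last first.
  have [d d0 dy] := scalable01_exists (row y N).
  apply: (torus01 _ d0) => // i; have [Si|/outxy[->|-> //]] := boolP (S i || pred2 z t i).
    by apply: monomial_scalable01 => //; apply: mono.
  apply: (scalable01_single (e := a)) => // e ea.
  by have := xa e; rewrite ea /= negbK mxE => /eqP.
pose l := N y b / N x b.
(* The multiple of row x clears column b of row y; that of row z, a unit vector, then corrects
   column a. *)
pose w j := if j == x then - l else if j == z then l * N x a - N y a else 0.
have [|N' [NN' yN' jN']] := row_addl Rrefl N (i := y) (w := w).
  move=> j; rewrite /w; have [->|_] := eqVneq j x; rewrite ?Rxy //.
  by have [->|] := eqVneq j z; rewrite ?Rzy // eqxx.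
apply: reduces01_trans NN' _ => //.
have [d d0 dx] := scalable01_exists (row x N).
apply: (torus01 _ d0) => // i; have [Si|/outxy[->|->]] := boolP (S i || pred2 z t i).
- rewrite jN'; first by apply: monomial_scalable01 => //; apply: mono.
  move: Si; apply: contraL => /eqP ->; rewrite /= negb_or; apply/andP; split.
    by apply/negP => /Sin; rewrite !inE eqxx !orbT.
  by rewrite negb_or eq_sym zy eq_sym ty.
- by rewrite jN'.
have [c cab] := ord3_other ba; apply: (scalable01_single (e := c)) => // e ec.
have zN e' : N z e' = (e' == a)%:R.
  by have := congr1 (fun v : 'rV_3 => v 0 e') za; rewrite !mxE eqxx.
have -> : row y N' 0 e = N y e + (- l * N x e + (l * N x a - N y a) * N z e).
  rewrite yN' mxE summxE (bigD1 x) //= (bigD1 z) //= big1 => [|j /andP[/negPf jx /negPf jz]].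
    by rewrite /w !eqxx (negPf zx) addr0 !mxE.
  by rewrite /w jx jz scale0r mxE.
rewrite zN; have [->|eb] := eqVneq e b.
  by rewrite (negPf ba) mulr0 addr0 mulNr mulfVK // subrr.
have -> : e = a by apply/eqP; apply: contra_neqT ec => ea; apply: cab.
by rewrite eqxx mulr1 mulNr addKr subrr.
Qed.

(** Rows x and y may be added to each other, so elimination gives each its own pivot column. If both
    survive, scaling the two pivot columns makes each pivot equal to the entry of its row in the
    third column, when that is nonzero, and row factors finish. *)
Lemma tied_chains_dim3 S1 S2 x y k : injective k -> chain R k S1 -> chain R k S2 ->
  (forall i, ~~ (S1 i && S2 i)) -> (forall i, ~~ (S1 i || S2 i) -> i = x \/ i = y) ->
  ~~ (S1 x || S2 x) -> ~~ (S1 y || S2 y) -> x != y -> R x y -> R y x ->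
  reducible01 K 3 R.
Proof.
move=> kinj ch1 ch2 S12 Sxy Sx Sy xy Rxy Ryx; apply: reducible01P => N0.
have [N1 [g [N0N ug mono1 _]]] := two_chains Rrefl N0 kinj ch1 ch2 S12.
apply: reduces01_trans N0N _ => //.
have [x0|/rV0Pn[a xa]] := eqVneq (row x N1) 0.
  have [d d0 dy] := scalable01_exists (row y N1).
  apply: (torus01 _ d0) => // i; have [Si|/Sxy[->|-> //]] := boolP (S1 i || S2 i).
    by apply: monomial_scalable01 => //; apply: mono1.
  by apply: monomial_scalable01 => //; left.
have {}xa : N1 x a != 0 by rewrite mxE in xa.
have add i j N c : R j i -> i != j -> exists N' : 'M[K]_(n, 3),
    [/\ row_equiv R N N', forall e, N' i e = N i e + c * N j e &
     forall l, l != i -> row l N' = row l N].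
  move=> Rji ij; pose w l := if l == j then c else 0.
  have [|N' [NN' iN' lN']] := row_addl Rrefl N (i := i) (w := w).
    by move=> l; rewrite /w; have [->|] := eqVneq l j; rewrite ?Rji ?(eq_sym j) // eqxx.
  exists N'; split=> // e.
  have := congr1 (fun v : 'rV_3 => v 0 e) iN'; rewrite mxE => ->.
  rewrite mxE summxE (bigD1 j) //= big1 => [|l /negPf lj].
    by rewrite /w eqxx addr0 !mxE.
  by rewrite /w lj scale0r mxE.
have yx : y != x by rewrite eq_sym.
have [N2 [N12 yN2 lN2]] := add y x N1 (- (N1 y a / N1 x a)) Rxy yx.
apply: reduces01_trans N12 _ => //.
have xN2 e : N2 x e = N1 x e.
  by have := congr1 (fun v : 'rV_3 => v 0 e) (lN2 x xy); rewrite !mxE.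
have mono2 i : S1 i || S2 i -> monomial_row (row i N2).
  move=> Si; rewrite lN2; first exact: mono1.
  by apply: contraNneq Sy => <-.
have ya : N2 y a = 0 by rewrite yN2 mulNr mulfVK // subrr.
have [y0|/rV0Pn[b yb]] := eqVneq (row y N2) 0.
  have [d d0 dx] := scalable01_exists (row x N2).
  apply: (torus01 _ d0) => // i; have [Si|/Sxy[-> //|->]] := boolP (S1 i || S2 i).
    by apply: monomial_scalable01 => //; apply: mono2.
  by apply: monomial_scalable01 => //; left.
have {}yb : N2 y b != 0 by rewrite mxE in yb.
have ba : b != a by apply: contraNneq yb => ->; rewrite ya.
have [N3 [N23 xN3 lN3]] := add x y N2 (- (N2 x b / N2 y b)) Ryx xy.
apply: reduces01_trans N23 _ => //.
have yN3 e : N3 y e = N2 y e.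
  by have := congr1 (fun v : 'rV_3 => v 0 e) (lN3 y yx); rewrite !mxE.
have mono3 i : S1 i || S2 i -> monomial_row (row i N3).
  move=> Si; rewrite lN3; first exact: mono2.
  by apply: contraNneq Sx => <-.
have xb : N3 x b = 0 by rewrite xN3 mulNr mulfVK // subrr.
have ya3 : N3 y a = 0 by rewrite yN3.
have xa3 : N3 x a != 0 by rewrite xN3 ya mulr0 addr0 xN2.
have yb3 : N3 y b != 0 by rewrite yN3.
have [c cab] := ord3_other ba.
(* the two rows have the shape (p, 0, s) and (0, q, t) at (a, b, c) *)
pose s := if N3 x c == 0 then 1 else N3 x c / N3 x a.
pose t := if N3 y c == 0 then 1 else N3 y c / N3 y b.
have s0 : s != 0.
  by rewrite /s; case: ifPn => [_|c0]; [apply: oner_neq0|rewrite mulf_neq0 ?invr_neq0].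
have t0 : t != 0.
  by rewrite /t; case: ifPn => [_|c0]; [apply: oner_neq0|rewrite mulf_neq0 ?invr_neq0].
pose d : 'rV[K]_3 := \row_e if e == a then s else if e == b then t else 1.
have d0 e : d 0 e != 0 by rewrite mxE; do 2!case: ifP => _ //; apply: oner_neq0.
apply: (torus01 _ d0) => // i; have [Si|/Sxy[->|->]] := boolP (S1 i || S2 i).
- by apply: monomial_scalable01 => //; apply: mono3.
- exists (N3 x a * s)^-1; first by rewrite invr_neq0 // mulf_neq0.
  move=> e; rewrite mul_mx_diag !mxE; have [->|ea] := eqVneq e a.
    by right; rewrite mulVf // mulf_neq0.
  have [->|eb] := eqVneq e b; first by left; rewrite xb mul0r mulr0.
  rewrite (cab e eb ea) mulr1 /s; case: eqVneq => [->|c0]; first by left; rewrite mulr0.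
  by right; rewrite mulrCA mulfV // mulr1 mulVf.
- exists (N3 y b * t)^-1; first by rewrite invr_neq0 // mulf_neq0.
  move=> e; rewrite mul_mx_diag !mxE; have [->|ea] := eqVneq e a.
    by left; rewrite ya3 mul0r mulr0.
  have [->|eb] := eqVneq e b; first by right; rewrite mulVf // mulf_neq0.
  rewrite (cab e eb ea) mulr1 /t; case: eqVneq => [->|c0]; first by left; rewrite mulr0.
  by right; rewrite mulrCA mulfV // mulr1 mulVf.
Qed.

Lemma dim1_reducible01 : reducible01 K 1 R.
Proof.
apply: reducible01P => N; pose d : 'rV[K]_1 := const_mx 1.
have d0 e : d 0 e != 0 by rewrite mxE oner_neq0.
apply: (torus01 _ d0) => // i; apply: (scalable01_single (e := 0)) => // e.
by rewrite (ord1 e).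
Qed.

End SmallDimension.

(** * Infinitely many orbits *)

Section Labels.

Lemma card_pred_ord n (P : pred 'I_n) : #|P| = \sum_(j < n) P j.
Proof. by rewrite -sum1_card big_mkcond. Qed.

Lemma sumn_nth (a : seq nat) : sumn a = \sum_(i < size a) nth 0 a i.
Proof. by rewrite sumnE (big_nth 0) big_mkord. Qed.

Lemma extend_labels n m (a : seq nat) (l0 : 'I_n -> nat) :
    (forall j, l0 j < size a) ->
    (forall i, i < size a -> #|[pred j | l0 j == i]| <= nth 0 a i) ->
    sumn a = n + m ->
  exists2 l : 'I_(n + m) -> nat, labels a l & forall j, l (lshift m j) = l0 j.
Proof.
move=> l0a cl0 suma; pose c i := #|[pred j | l0 j == i]|.
pose s := flatten [seq nseq (nth 0 a i - c i) i | i <- iota 0 (size a)].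
have sumc : \sum_(i < size a) c i = n.
  transitivity (\sum_(i < size a) \sum_(j < n) (l0 j == i)).
    by apply: eq_bigr => i _; rewrite /c card_pred_ord.
  rewrite exchange_big /= -[RHS]card_ord -sum1_card; apply: eq_bigr => j _.
  rewrite (bigD1 (Ordinal (l0a j))) //= eqxx big1 // => i.
  by rewrite -val_eqE /= eq_sym => /negPf->.
have sizes : size s = m.
  rewrite size_flatten /shape -map_comp sumnE big_map.
  rewrite -{1}[size a]subn0 -/(index_iota 0 _) big_mkord.
  have: \sum_(i < size a) (nth 0 a i - c i) + \sum_(i < size a) c i = n + m.
    rewrite -suma sumn_nth -big_split; apply: eq_bigr => i _.
    exact/subnK/cl0.
  rewrite sumc => H; apply: (@addnI n); rewrite -H addnC; congr (_ + _).
  by apply: eq_bigr => i _; rewrite /= size_nseq.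
exists (fun j => match split j with inl j => l0 j | inr j => nth 0 s j end); last first.
  by move=> j; have := unsplitK (inl j : 'I_n + 'I_m) => /= ->.
split=> [j|i ia].
  case: split => // k; have: nth 0 s k \in s by rewrite mem_nth ?sizes.
  case/flattenP => _ /mapP[i ia ->]; rewrite mem_nseq => /andP[_ /eqP->].
  by rewrite mem_iota in ia.
rewrite card_pred_ord big_split_ord /=.
have -> : nth 0 a i = c i + (nth 0 a i - c i) by rewrite subnKC // cl0.
congr (_ + _).
  rewrite /c card_pred_ord; apply: eq_bigr => j _ /=.
  by have := unsplitK (inl j : 'I_n + 'I_m) => /= ->.
transitivity (count_mem i s).
  rewrite -sum1_count (big_nth 0) sizes big_mkord [RHS]big_mkcond /=.
  apply: eq_bigr => j _; have := unsplitK (inr j : 'I_n + 'I_m) => /= ->.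
  by case: eqP.
rewrite count_flatten -map_comp sumnE big_map.
rewrite -{1}[size a]subn0 -/(index_iota 0 _) big_mkord.
rewrite (bigD1 (Ordinal ia)) //= count_nseq /= eqxx mul1n big1 ?addn0 // => k.
by rewrite -val_eqE /= count_nseq /= => /negPf->.
Qed.

(** The labels [t] are moved increasingly onto parts of size at least k, where their fibres fit.
    Strict monotonicity is what makes the corner block of an [incid] matrix [incid] for [t]. *)
Lemma embed_labels n m (a : seq nat) k N (t : 'I_n -> nat) :
    N <= count (leq k) a -> (forall j, t j < N) ->
    (forall x, #|[pred j | t j == x]| <= k) -> sumn a = n + m ->
  exists2 l : 'I_(n + m) -> nat, labels a l &
    forall i j, t i < t j -> l (lshift m i) < l (lshift m j).
Proof.
move=> Na tN tk suma.
pose s := [seq i <- iota 0 (size a) | k <= nth 0 a i].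
have sizes : N <= size s.
  rewrite size_filter; apply: leq_trans Na _.
  by rewrite -{1}(mkseq_nth 0 a) /mkseq count_map.
have srt : sorted ltn s by rewrite sorted_filter ?iota_ltn_sorted //; apply: ltn_trans.
have sP i : i < N -> nth 0 s i < size a /\ k <= nth 0 a (nth 0 s i).
  move=> iN; have: nth 0 s i \in s by rewrite mem_nth // (leq_trans iN).
  by rewrite mem_filter mem_iota /= => /andP[].
have smono i j : i < j -> j < N -> nth 0 s i < nth 0 s j.
  move=> ij jN; apply: (sorted_ltn_nth ltn_trans) => //.
    by rewrite inE (leq_trans (ltn_trans ij jN)).
  by rewrite inE (leq_trans jN).
have [||//|l la lE] := @extend_labels n m a (fun j => nth 0 s (t j)).
- by move=> j; case: (sP (t j)).
- move=> i ia; have [/existsP[j /eqP ji]|/existsPn ni] :=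
    boolP [exists j, nth 0 s (t j) == i]; last first.
    by rewrite eq_card0 // => j; rewrite inE (negPf (ni j)).
  apply: leq_trans (_ : k <= _); last by rewrite -ji; case: (sP (t j)).
  apply: leq_trans (tk (t j)); apply/subset_leq_card/fintype.subsetP => j'.
  rewrite !inE -ji; apply: contraLR; rewrite !neq_ltn.
  by case/orP => tj; apply/orP; [left|right]; apply: smono.
by exists l => // i j tij; rewrite !lE smono.
Qed.

End Labels.

Section InfinitelyManyOrbits.
Variable (K : closedFieldType).
Local Open Scope ring_scope.
Local Open Scope classical_set_scope.

(** If [s] listed all elements of K, the polynomial with roots [s], plus 1, would have no root. *)
Lemma closed_field_infinite : infinite_set [set: K].
Proof.
move=> /finite_seqP[s sE].
have inS (x : K) : x \in s by have : [set` s] x by rewrite -sE.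
have [x] : exists x, root (\prod_(z <- s) ('X - z%:P) + 1 : {poly K}) x.
  apply/closed_rootP; rewrite size_polyDl ?size_prod_XsubC ?size_poly1 //.
    by case: (s) (inS 0).
  by case: (s) (inS 0).
rewrite /root hornerD hornerC => /eqP x0.
have /eqP : (\prod_(z <- s) ('X - z%:P)).[x] == 0 :> K.
  by rewrite -/(root _ _) root_prod_XsubC inS.
by move=> px; move: x0; rewrite px add0r => /eqP; rewrite oner_eq0.
Qed.

Lemma infinite_uniq_seq (A : set K) N : infinite_set A ->
  exists s : seq K, [/\ uniq s, size s = N & forall x, x \in s -> A x].
Proof.
move=> infA; elim: N => [|N [s [us ss sA]]]; first by exists [::].
have [x [Ax xs]] : exists x, A x /\ x \notin s.
  apply: contra_notP infA => noX; apply: (@sub_finite_set _ _ [set` s]).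
    move=> x Ax /=; apply/negPn/negP => xs; apply: noX; by exists x.
  exact: finite_seq.
exists (x :: s); split=> /=; rewrite ?xs ?ss // => y.
by rewrite inE => /predU1P[->|/sA].
Qed.

Lemma lfun_mxE n (g : 'End('rV[K]_n)) : bijective g ->
  exists2 P : 'M[K]_n, P \in unitmx & g = linfun (mulmxr P).
Proof.
move=> bg; have gE v : g v = v *m lin1_mx g by rewrite mul_rV_lin1.
exists (lin1_mx g); last by apply/lfunP => v; rewrite lfunE /= -gE.
rewrite -row_free_unit -kermx_eq0; apply/rowV0P => v; rewrite sub_kermx -gE => /eqP v0.
by apply: (bij_inj bg); rewrite v0 linear0.
Qed.

(* If n + 1 of the triples of flags built from the T t, which are pairwise
   Hom-orthogonal bricks up to a fixed direct summand, were isomorphic, then all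
   these bricks would be independent direct summands of a space of dimension n. *)
Lemma infinite_orbits n m p q r (a : p.-tuple nat) (b : q.-tuple nat)
    (c : r.-tuple nat) (T : K -> 'M[K]_n.+1) (ta tb tc : 'I_n.+1 -> nat)
    (ka kb kc Na Nb Nc : nat) :
    (forall t, T t \in unitmx) ->
    (forall s t f h, s != t -> incid tb f -> incid tc f -> incid ta h ->
      T s *m f = h *m T t -> f 0 0 = 0) ->
    (Na <= count (leq ka) a)%N -> (forall j, ta j < Na)%N ->
    (forall x, #|[pred j | ta j == x]| <= ka)%N ->
    (Nb <= count (leq kb) b)%N -> (forall j, tb j < Nb)%N ->
    (forall x, #|[pred j | tb j == x]| <= kb)%N ->
    (Nc <= count (leq kc) c)%N -> (forall j, tc j < Nc)%N ->
    (forall x, #|[pred j | tc j == x]| <= kc)%N ->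
    sumn a = (n.+1 + m)%N -> sumn b = (n.+1 + m)%N -> sumn c = (n.+1 + m)%N ->
  ~ finite_orbits K (n.+1 + m) a b c.
Proof.
move=> uT rigid aN ta1 ta2 bN tb1 tb2 cN tc1 tc2 sa sb sc.
have [al ala al0] := embed_labels aN ta1 ta2 sa.
have [be beb be0] := embed_labels bN tb1 tb2 sb.
have [ga gac ga0] := embed_labels cN tc1 tc2 sc.
(* The parameter enters the first flag only, through the brick [T t] completed by a fixed
   summand. *)
pose M t : 'M[K]_(n.+1 + m) := block_mx (T t) 0 0 1%:M.
have uM t : M t \in unitmx.
  by rewrite unitmxE det_ublock det1 mulr1 -unitmxE.
pose G t := (cflag p al (M t), cflag q be (1%:M : 'M[K]_(n.+1 + m)),
  cflag r ga (1%:M : 'M[K]_(n.+1 + m))).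
have FG t : GL_orbit (G t) \in [set GL_orbit F |
    F in Fl 'rV[K]_(n.+1 + m) a `*` Fl 'rV[K]_(n.+1 + m) b `*` Fl 'rV[K]_(n.+1 + m) c].
  rewrite inE; exists (G t) => //; by split; [split|] => /=;
    apply: Fl_cflag => //; rewrite unitmx1.
move=> fin.
(* Finitely many orbits, each met by finitely many parameters, would make K finite. *)
have [t0 inft0] : exists t0, infinite_set [set t | GL_orbit (G t) = GL_orbit (G t0)].
  apply: contrapT => nofib; apply: closed_field_infinite.
  have cov : [set: K] `<=` \bigcup_(O in [set GL_orbit F |
    F in Fl 'rV[K]_(n.+1 + m) a `*` Fl 'rV[K]_(n.+1 + m) b `*` Fl 'rV[K]_(n.+1 + m) c])
      [set t | GL_orbit (G t) = O].
    by move=> t _; exists (GL_orbit (G t)) => //; have := FG t; rewrite inE.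
  apply: sub_finite_set cov _; apply: bigcup_finite => // O _.
  have [[t tO]|noO] := pselect (exists t, GL_orbit (G t) = O).
    by rewrite -tO; apply: contrapT => inft; apply: nofib; exists t.
  apply: (@sub_finite_set _ _ set0) => // t /= tO; apply: noO; by exists t.
have [s [us ss sP]] := infinite_uniq_seq (n.+1 + m).+1 inft0.
pose t (i : 'I_(n.+1 + m).+1) := nth 0 s i.
have tP i : exists P, P \in unitmx /\ G (t i) = 
    (cflag p al (M t0 *m P), cflag q be P, cflag r ga P).
  have : GL_orbit (G t0) (G (t i)).
    have <- : GL_orbit (G (t i)) = GL_orbit (G t0) by apply: sP; rewrite mem_nth ?ss.
    exact: GL_orbit_refl.
  case=> g /lfun_mxE[P uP ->] ->; exists P; split=> //.
  by rewrite !cflag_act /= !mul1mx.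
have [P {}tP] := fin_all_exists tP.
have uP i : P i \in unitmx by case: (tP i).
have incidP l (lab : 'I_(n.+1 + m) -> nat) (X Y : 'M[K]_(n.+1 + m)) :
    Y \in unitmx -> (forall j, lab j < l)%N -> cflag l lab X = cflag l lab Y ->
    incid lab (X *m invmx Y).
  move=> uY labl XY; apply: incid_of_cspace => // j.
  by have := congr1 (fun A : l.+1.-tuple _ => nth 0%VS A (lab j).+1) XY; rewrite !nth_cflag.
pose x0 : 'I_(n.+1 + m) := lshift m 0.
(* For i different from j, [phi] is an isomorphism from the triple of [t i] to that of [t j]; its
   corner block is a morphism of bricks, to which [rigid] applies. *)
have PV i j : (invmx (P i) *m P j) x0 x0 = (i == j)%:R.
  have [->|ij] := eqVneq i j; first by rewrite mulVmx // mxE eqxx.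
  set phi := _ *m _.
  have tE l : G (t l) = (cflag p al (M t0 *m P l), cflag q be (P l), cflag r ga (P l)).
    by case: (tP l).
  have tr l (lab : 'I_(n.+1 + m) -> nat) (X Y : 'M_(n.+1 + m))
      (Z : 'I_(n.+1 + m).+1 -> 'M[K]_(n.+1 + m)) :
      cflag l lab X = cflag l lab (Z i) -> cflag l lab Y = cflag l lab (Z j) ->
      (Z i *m phi = Z j) -> cflag l lab (X *m phi) = cflag l lab Y.
    by move=> XZ YZ ZE; rewrite -cflag_act XZ cflag_act ZE YZ.
  have phiE (Z : 'M[K]_(n.+1 + m)) : Z *m P i *m phi = Z *m P j.
    by rewrite /phi mulmxA mulmxK.
  have tA l := congr1 (fun F : flag3 _ p q r => F.1.1) (tE l).
  have tB l := congr1 (fun F : flag3 _ p q r => F.1.2) (tE l).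
  have tC l := congr1 (fun F : flag3 _ p q r => F.2) (tE l).
  have incA : incid al (M (t i) *m phi *m invmx (M (t j))).
    apply: (@incidP p) => //.
      by move=> l; case: ala => + _ => /(_ l); rewrite size_tuple.
    exact: (tr p al _ _ (fun l => M t0 *m P l) (tA i) (tA j) (phiE (M t0))).
  have phiE' : P i *m phi = P j by rewrite -[P i]mul1mx phiE mul1mx.
  have incB : incid be phi.
    have := @incidP q be (1%:M *m phi) 1%:M; rewrite invmx1 mulmx1 mul1mx; apply.
    - exact: unitmx1.
    - by move=> l; case: beb => + _ => /(_ l); rewrite size_tuple.
    - by have := tr q be _ _ P (tB i) (tB j) phiE'; rewrite mul1mx.
  have incC : incid ga phi.
    have := @incidP r ga (1%:M *m phi) 1%:M; rewrite invmx1 mulmx1 mul1mx; apply.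
    - exact: unitmx1.
    - by move=> l; case: gac => + _ => /(_ l); rewrite size_tuple.
    - by have := tr r ga _ _ P (tC i) (tC j) phiE'; rewrite mul1mx.
  pose h := M (t i) *m phi *m invmx (M (t j)).
  have hE : M (t i) *m phi = h *m M (t j) by rewrite mulmxKV.
  have sub (lab : 'I_(n.+1 + m) -> nat) (tl : 'I_n.+1 -> nat) (X : 'M[K]_(n.+1 + m)) :
      (forall i j, tl i < tl j -> lab (lshift m i) < lab (lshift m j))%N ->
      incid lab X -> incid tl (ulsubmx X).
    move=> lt iX i' j'; rewrite !mxE => /iX; apply: contraTT.
    by rewrite -!ltnNge => /lt.
  have := rigid (t i) (t j) (ulsubmx phi) (ulsubmx h).
  rewrite !mxE; apply.
  - by rewrite nth_uniq ?ss.
  - exact: sub be0 incB.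
  - exact: sub ga0 incC.
  - exact: sub al0 incA.
  have := congr1 ulsubmx hE; rewrite -{1}[phi]submxK -{1}[h]submxK /M.
  by rewrite !mulmx_block !block_mxKul !mul0mx !mulmx0 !addr0.
(* There is one parameter more than the dimension, so [X *m Y] cannot have the rank of an identity
   matrix. *)
pose X : 'M[K]_((n.+1 + m).+1, n.+1 + m) := \matrix_(i, j) invmx (P i) x0 j.
pose Y : 'M[K]_(n.+1 + m, (n.+1 + m).+1) := \matrix_(i, j) P j i x0.
have XY : X *m Y = 1%:M.
  apply/matrixP => i j; rewrite [RHS]mxE -PV !mxE.
  by apply: eq_bigr => l _; rewrite !mxE.
have := mxrankM_maxl X Y; rewrite XY mxrank1 => /leq_trans/(_ (rank_leq_col X)).
by rewrite ltnn.
Qed.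

End InfinitelyManyOrbits.

(** * The one-parameter families of types E6, E7 and E8 *)

Section CriticalTriples.
Variable (K : closedFieldType).
Local Open Scope ring_scope.

Lemma mul_count_sumn k (a : seq nat) : (k * count (leq k) a <= sumn a)%N.
Proof.
elim: a => [|x a IHa] /=; first by rewrite muln0.
by rewrite mulnDr leq_add //; case: (leqP k x) => /= kx; rewrite ?muln1 ?muln0.
Qed.

Definition mx_of (n : nat) (rows : seq (seq K)) : 'M[K]_n :=
  \matrix_(i, j) nth 0 (nth [::] rows i) j.

Definition upper_unitri n (rows : seq (seq K)) :=
  all (fun i => (nth 0 (nth [::] rows i) i == 1) &&
    all (fun j => nth 0 (nth [::] rows i) j == 0) (iota 0 i)) (iota 0 n).

Lemma mx_of_unit n rows : upper_unitri n rows -> mx_of n rows \in unitmx.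
Proof.
move=> /allP up; rewrite -unitmx_tr unitmxE det_trig.
  rewrite big1 ?unitr1 // => i _; rewrite !mxE.
  by have /andP[/eqP] := up i (etrans (mem_iota 0 n i) (ltn_ord i)).
apply/is_trig_mxP => i j ij; rewrite !mxE.
have /andP[_ /allP/(_ i)] := up j (etrans (mem_iota 0 n j) (ltn_ord j)).
by rewrite mem_iota => /(_ ij)/eqP.
Qed.

Lemma mx_of_mull n rows (f : 'M[K]_n.+1) i j : (i < n.+1)%N -> (j < n.+1)%N ->
  (mx_of n.+1 rows *m f) (inord i) (inord j) =
  \sum_(0 <= k < n.+1) nth 0 (nth [::] rows i) k * f (inord k) (inord j).
Proof.
move=> ni nj; rewrite big_mkord mxE; apply: eq_bigr => k _.
by rewrite mxE inordK // inord_val.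
Qed.

Lemma mx_of_mulr n rows (f : 'M[K]_n.+1) i j : (i < n.+1)%N -> (j < n.+1)%N ->
  (f *m mx_of n.+1 rows) (inord i) (inord j) =
  \sum_(0 <= k < n.+1) f (inord i) (inord k) * nth 0 (nth [::] rows k) j.
Proof.
move=> ni nj; rewrite big_mkord mxE; apply: eq_bigr => k _.
by rewrite mxE inordK // inord_val.
Qed.

Lemma incid0 n (t : 'I_n.+1 -> nat) (f : 'M[K]_n.+1) (i j : nat) :
  incid t f -> (t (inord i) < t (inord j))%N -> f (inord i) (inord j) = 0.
Proof. by move=> tf; rewrite ltnNge => /negP H; apply/eqP/negPn/negP => /tf. Qed.

(** Trades the entries of [f] for a function on numerals that is visibly zero outside [P], so that
    the matrix equations simplify by computation. *)
Lemma mx_entries n (f : 'M[K]_n.+1) (P : rel nat) :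
  (forall i j, (i < n.+1)%N -> (j < n.+1)%N -> ~~ P i j ->
    f (inord i) (inord j) = 0) ->
  exists F : nat -> nat -> K, f 0 0 = f (inord 0) (inord 0) /\
    forall i j, (i < n.+1)%N -> (j < n.+1)%N ->
    f (inord i) (inord j) = if P i j then F i j else 0.
Proof.
move=> f0; exists (fun i j => f (inord i) (inord j)); split=> [|i j ni nj].
  by congr (f _ _); apply: val_inj; rewrite /= inordK.
by case: ifPn => // /f0->.
Qed.

Lemma mx_of_eq n rows rows' (f h : 'M[K]_n.+1) i j :
  mx_of n.+1 rows *m f = h *m mx_of n.+1 rows' -> (i < n.+1)%N -> (j < n.+1)%N ->
  \sum_(0 <= k < n.+1) nth 0 (nth [::] rows i) k * f (inord k) (inord j) =
  \sum_(0 <= k < n.+1) h (inord i) (inord k) * nth 0 (nth [::] rows' k) j.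
Proof. by move=> E ni nj; rewrite -mx_of_mull // E mx_of_mulr. Qed.

Lemma card_fiber n (t : 'I_n -> nat) x :
  #|[pred j | t j == x]| = (\sum_(j < n) (t j == x))%N.
Proof. exact: card_pred_ord. Qed.

Local Definition simp01 := (mul0r, mulr0, mul1r, mulr1, add0r, addr0).

Lemma mul_comm_eq0 (s t x : K) : s != t -> s * x = x * t -> x = 0.
Proof.
move=> st /eqP; rewrite mulrC -subr_eq0 -mulrBr mulf_eq0 => /orP[/eqP //|].
by rewrite subr_eq0 (negPf st).
Qed.

(** The labels j and 2 - j give opposite complete flags, so [f] is diagonal. The first row of the
    equation makes [f] scalar, and the entry (1, 2), where the parameter sits, gives s x = x t. *)
Lemma infinite_E6 n p q r (a : p.-tuple nat) (b : q.-tuple nat) (c : r.-tuple nat) :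
    sumn a = n -> sumn b = n -> sumn c = n ->
    (3 <= count (leq 1) a)%N -> (3 <= count (leq 1) b)%N ->
    (3 <= count (leq 1) c)%N ->
  ~ finite_orbits K n a b c.
Proof.
move=> sa sb sc ca cb cc.
have [m nE] : exists m, n = (3 + m)%N.
  by exists (n - 3)%N; have := mul_count_sumn 1 a; lia.
rewrite nE in sa sb sc *.
pose rows (t : K) := [:: [:: 1; 1; 1]; [:: 0; 1; t]; [:: 0; 0; 1]].
apply: (@infinite_orbits K 2 m p q r a b c (fun t => mx_of 3 (rows t))
  (fun j => j) (fun j => j) (fun j => (2 - j)%N) 1 1 1 3 3 3) => //.
- by move=> t; apply: mx_of_unit; rewrite /upper_unitri /= !eqxx.
- move=> s t f h st fb fc ha /mx_of_eq E.
  have [|F [-> fE]] := @mx_entries 2 f eq_op.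
    move=> i j i3 j3; rewrite neq_ltn => /orP[ij|ji].
      by apply: (incid0 fb); rewrite !inordK.
    by apply: (incid0 fc); rewrite !inordK //; lia.
  have [|H [_ hE]] := @mx_entries 2 h (fun i j => j <= i)%N.
    by move=> i j i3 j3 ij; apply: (incid0 ha); rewrite !inordK // ltnNge.
  have := (E 0 0 isT isT, E 0 1 isT isT, E 1 0 isT isT, E 1 1 isT isT,
     E 1 2 isT isT, E 0 2 isT isT)%N.
  rewrite !unlock /= !fE // !hE //= !simp01.
  case=> [[[[[F0 F1] H10] F1'] F2] F2'].
  apply: (mul_comm_eq0 st); rewrite {1}F0 -F2' F2 -H10 add0r; congr (_ * _).
  by rewrite F0 -F1 F1' -H10 add0r.
- by move=> x; rewrite card_fiber !big_ord_recl big_ord0 /=; case: x => [|[|[|]]].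
- by move=> x; rewrite card_fiber !big_ord_recl big_ord0 /=; case: x => [|[|[|]]].
- by move=> j; rewrite ltnS leq_subr.
- by move=> x; rewrite card_fiber !big_ord_recl big_ord0 /=; case: x => [|[|[|]]].
Qed.

(** Again [f] is diagonal. The columns of the first two rows are four points of the projective line,
    and t is their cross-ratio. *)
Lemma infinite_E7 n p q r (a : p.-tuple nat) (b : q.-tuple nat) (c : r.-tuple nat) :
    sumn a = n -> sumn b = n -> sumn c = n ->
    (2 <= count (leq 2) a)%N -> (4 <= count (leq 1) b)%N ->
    (4 <= count (leq 1) c)%N ->
  ~ finite_orbits K n a b c.
Proof.
move=> sa sb sc ca cb cc.
have [m nE] : exists m, n = (4 + m)%N.
  by exists (n - 4)%N; have := mul_count_sumn 1 b; lia.
rewrite nE in sa sb sc *.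
pose rows (t : K) :=
  [:: [:: 1; 0; 1; 1]; [:: 0; 1; 1; t]; [:: 0; 0; 1; 0]; [:: 0; 0; 0; 1]].
apply: (@infinite_orbits K 3 m p q r a b c (fun t => mx_of 4 (rows t))
  (fun j => j./2) (fun j => j) (fun j => (3 - j)%N) 2 1 1 2 4 4) => //.
- by move=> t; apply: mx_of_unit; rewrite /upper_unitri /= !eqxx.
- move=> s t f h st fb fc ha /mx_of_eq E.
  have [|F [-> fE]] := @mx_entries 3 f eq_op.
    move=> i j i4 j4; rewrite neq_ltn => /orP[ij|ji].
      by apply: (incid0 fb); rewrite !inordK.
    by apply: (incid0 fc); rewrite !inordK //; lia.
  have [|H [_ hE]] := @mx_entries 3 h (fun i j => j./2 <= i./2)%N.
    by move=> i j i4 j4 ij; apply: (incid0 ha); rewrite !inordK // ltnNge.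
  have := (E 0 0 isT isT, E 0 1 isT isT, E 0 2 isT isT, E 0 3 isT isT)%N.
  have := (E 1 0 isT isT, E 1 1 isT isT, E 1 2 isT isT, E 1 3 isT isT)%N.
  rewrite !unlock /= !fE // !hE //= !simp01.
  case=> [[[H10 F1] F2] F3] [[[F0 H01] F2'] F3'].
  move: F2 F3 F2' F3'; rewrite -H10 -H01 mul0r !add0r !addr0 => F2 F3 F2' F3'.
  by apply: (mul_comm_eq0 st); rewrite F0 -{1}F3' F3 -F2 F2'.
- by move=> j; have := ltn_ord j; lia.
- by move=> x; rewrite card_fiber !big_ord_recl big_ord0 /=; case: x => [|[|[|[]]]].
- by move=> x; rewrite card_fiber !big_ord_recl big_ord0 /=; case: x => [|[|[|[]]]].
- by move=> j; have := ltn_ord j; lia.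
- by move=> x; rewrite card_fiber !big_ord_recl big_ord0 /=; case: x => [|[|[|[]]]].
Qed.

Lemma infinite_E8 n p q r (a : p.-tuple nat) (b : q.-tuple nat) (c : r.-tuple nat) :
    sumn a = n -> sumn b = n -> sumn c = n ->
    (2 <= count (leq 3) a)%N -> (3 <= count (leq 2) b)%N ->
    (6 <= count (leq 1) c)%N ->
  ~ finite_orbits K n a b c.
Proof.
move=> sa sb sc ca cb cc.
have [m nE] : exists m, n = (6 + m)%N.
  by exists (n - 6)%N; have := mul_count_sumn 1 c; lia.
rewrite nE in sa sb sc *.
(* The first three rows give six vectors of K^3, the columns; they form three
   complete flags, whose modulus is t. *)
pose rows (t : K) := [:: [:: 1; 0; 0; 0; 1; 0]; [:: 0; 1; 0; 1; 1; 1];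
  [:: 0; 0; 1; 0; 1; t]; [:: 0; 0; 0; 1]; [:: 0; 0; 0; 0; 1]; [:: 0; 0; 0; 0; 0; 1]].
apply: (@infinite_orbits K 5 m p q r a b c (fun t => mx_of 6 (rows t))
  (fun j => j %/ 3)%N (fun j => j./2) (fun j => (5 - j)%N) 3 2 1 2 3 6) => //.
- by move=> t; apply: mx_of_unit; rewrite /upper_unitri /= !eqxx.
- move=> s t f h st fb fc ha /mx_of_eq E.
  (* Preserving a flag with three steps of dimension 2 and an opposite complete flag makes [f] upper
     triangular inside three diagonal blocks of size 2. *)
  have [|F [-> fE]] := @mx_entries 5 f (fun i j => (i <= j) && (j./2 <= i./2))%N.
    move=> i j i6 j6; rewrite negb_and -!ltnNge => /orP[ji|ij].
      by apply: (incid0 fc); rewrite !inordK //; lia.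
    by apply: (incid0 fb); rewrite !inordK.
  have [|H [_ hE]] := @mx_entries 5 h (fun i j => j %/ 3 <= i %/ 3)%N.
    by move=> i j i6 j6 ij; apply: (incid0 ha); rewrite !inordK // ltnNge.
  have := (E 0 0 isT isT, E 0 1 isT isT, E 0 2 isT isT,
    E 0 3 isT isT, E 0 4 isT isT, E 0 5 isT isT)%N.
  have := (E 1 0 isT isT, E 1 1 isT isT, E 1 2 isT isT,
    E 1 3 isT isT, E 1 4 isT isT, E 1 5 isT isT)%N.
  have := (E 2 0 isT isT, E 2 1 isT isT, E 2 2 isT isT,
    E 2 3 isT isT, E 2 4 isT isT, E 2 5 isT isT)%N.
  rewrite !unlock /= !fE // !hE //= !simp01.
  case=> [[[[[H20 H21] _] _] F4] F5]
    [[[[[H10 _] H12] _] F4'] F5']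
    [[[[[F0 _] H02] H01] F4''] F5''].
  move: F4 F5 F4' F5' F4'' F5''.
  rewrite -H20 -H21 -H10 -H12 -H02 -H01 !simp01 => F4 + F4' + F4'' F5'' => F5 F5'.
  move: F5 F5'; rewrite F5'' !add0r => F5 F5'.
  by apply: (mul_comm_eq0 st); rewrite F0 -F4'' F4' -{1}F5' F5 -F4 F4'.
- by move=> j; have := ltn_ord j; lia.
- by move=> x; rewrite card_fiber !big_ord_recl big_ord0 /=; case: x => [|[|[]]].
- by move=> j; have := ltn_ord j; lia.
- by move=> x; rewrite card_fiber !big_ord_recl big_ord0 /=; case: x => [|[|[|[]]]].
- by move=> j; have := ltn_ord j; lia.
- by move=> x; rewrite card_fiber !big_ord_recl big_ord0 /=; case: x => [|[|[|[|[|[|[]]]]]]].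
Qed.

End CriticalTriples.

(** * Finitely many orbits *)

Section Supports.

Lemma perm_part_of (a : seq nat) : perm_eq (part_of a) [seq x <- a | x != 0].
Proof. exact/permPl/perm_sort. Qed.

Lemma sumn_part_of (a : seq nat) : sumn (part_of a) = sumn a.
Proof.
rewrite (perm_sumn (perm_part_of a)); elim: a => //= x a <-.
by case: eqVneq => [->|].
Qed.

(** Keeps the positions of the sorted parts, so that the shape of [part_of a] can be read on the
    fibres of a labelling. *)
Lemma part_of_support (a : seq nat) : exists I : seq nat,
  [/\ uniq I, map (nth 0 a) I = part_of a & forall i, (i \in I) = (nth 0 a i != 0)].
Proof.
pose J := [seq i <- iota 0 (size a) | nth 0 a i != 0].
exists (sort (relpre (nth 0 a) geq) J); split.
- by rewrite sort_uniq filter_uniq ?iota_uniq.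
- rewrite -sort_map /part_of; congr sort.
  by rewrite -[in RHS](mkseq_nth 0 a) /mkseq filter_map.
- move=> i; rewrite mem_sort mem_filter mem_iota /=.
  by case: (ltnP i (size a)) => ia; rewrite ?andbT // nth_default.
Qed.

(** [u] is the nonzero part that comes first in [a]; as [part_of] forgets the order, it may be
    either one. *)
Lemma two_parts (a : seq nat) x y : part_of a = [:: x; y] ->
  exists2 u, u = x \/ u = y & forall i, sumn (take i a) \in [:: 0; u; x + y].
Proof.
move=> ax; have := perm_part_of a; rewrite ax => pa.
have suma := sumn_part_of a; rewrite ax /= addn0 in suma.
have := perm_size pa; case fE: [seq x <- a | x != 0] => [|u [|v []]] //= _.
rewrite fE in pa; exists u.
  by have := perm_mem pa u; rewrite !inE eqxx /= => /orP[]/eqP; [left|right].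
move=> i; have uv : u + v = x + y by have := perm_sumn pa; rewrite /= !addn0.
have : [seq x <- take i a | x != 0] ++ [seq x <- drop i a | x != 0] = [:: u; v].
  by rewrite -filter_cat cat_take_drop.
have <- : sumn [seq x <- take i a | x != 0] = sumn (take i a).
  by elim: (take i a) => //= z s <-; case: eqVneq => [->|].
case: [seq x <- take i a | x != 0] => [|z [|w []]] //= -[-> // ].
  by move=> _; rewrite !inE addn0 eqxx orbT.
by move=> -> _; rewrite !inE addn0 uv eqxx !orbT.
Qed.

Lemma one_part (a : seq nat) x : part_of a = [:: x] ->
  forall i, sumn (take i a) \in [:: 0; x].
Proof.
move=> ax i; have := perm_part_of a; rewrite ax => pa.
have := perm_size pa; case fE: [seq x <- a | x != 0] => [|u []] //= _.
rewrite fE in pa.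
have ux : u = x by have := perm_sumn pa; rewrite /= !addn0.
have : [seq x <- take i a | x != 0] ++ [seq x <- drop i a | x != 0] = [:: u].
  by rewrite -filter_cat cat_take_drop.
have <- : sumn [seq x <- take i a | x != 0] = sumn (take i a).
  by elim: (take i a) => //= z s <-; case: eqVneq => [->|].
case: [seq x <- take i a | x != 0] => [|z []] //= -[->] _.
by rewrite !inE addn0 ux eqxx orbT.
Qed.

End Supports.

Section LabelOrders.
Variables (n : nat) (l m : 'I_n -> nat).

Lemma label_rel_refl : reflexive (label_rel l m).
Proof. by move=> i; rewrite /label_rel !leqnn. Qed.

Lemma label_rel_trans : transitive (label_rel l m).
Proof.
move=> j i k /andP[lij mij] /andP[ljk mjk].
by rewrite /label_rel (leq_trans lij ljk) (leq_trans mij mjk).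
Qed.

(** Orders by [m] and breaks ties by the index, since [two_chains] asks for an injective key. *)
Definition label_key (j : 'I_n) := m j * n + j.

Lemma label_key_inj : injective label_key.
Proof.
move=> i j /(congr1 (modn^~ n)); rewrite /label_key !modnMDl !modn_small //.
exact: val_inj.
Qed.

Lemma label_keyP i j : label_key i <= label_key j -> m i <= m j.
Proof.
rewrite /label_key leqNgt => /negP H; rewrite leqNgt; apply/negP => mji; apply: H.
by have := ltn_ord j; nia.
Qed.

Lemma label_chain i0 : chain (label_rel l m) label_key [pred j | l j == i0].
Proof.
by move=> i j /= /eqP li /eqP lj /label_keyP mij; rewrite /label_rel li lj leqnn.
Qed.

Lemma label_mem (b : seq nat) (I : seq nat) : labels b l ->
  (forall i, (i \in I) = (nth 0 b i != 0)) -> forall j, l j \in I.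
Proof.
move=> [lb lc] IP j; rewrite IP -lc ?lb // -lt0n; apply/card_gt0P.
by exists j; rewrite inE.
Qed.

Lemma label_card (b : seq nat) (I : seq nat) i : labels b l ->
  (forall i, (i \in I) = (nth 0 b i != 0)) -> i \in I ->
  #|[pred j | l j == i]| = nth 0 b i.
Proof.
move=> [lb lc] IP; rewrite IP => bi; apply: lc; rewrite ltnNge.
by apply: contra bi => /(nth_default 0)->.
Qed.

Lemma card2_sorted (k : 'I_n -> nat) (P : pred 'I_n) : #|P| = 2 ->
  exists x y, [/\ x != y, k x <= k y & P =1 pred2 x y].
Proof.
move=> cP; have /cards2P[x [y [xy PE]]] : #|finset P| == 2 by rewrite cardsE cP.
have {}PE : P =1 pred2 x y.
  by move=> j; have := congr1 (fun A : {set 'I_n} => j \in A) PE;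
    rewrite !inE.
have [kxy|/ltnW kyx] := leqP (k x) (k y); first by exists x, y.
by exists y, x; rewrite eq_sym; split=> // j; rewrite PE /= orbC.
Qed.

End LabelOrders.

Section FiniteTriples.
Variable K : fieldType.

(** The fibres of [l] are chains, and the third has a single row. *)
Lemma reducible01_single n u (b : seq nat) x y (l m : 'I_n -> nat) :
  part_of b = [:: x; y; 1] -> labels b l -> reducible01 K u (label_rel l m).
Proof.
have [I [uI IE IP]] := part_of_support b; rewrite -IE => bE lb.
have lI := label_mem lb IP.
case: I uI IE bE IP lI => [|i1 [|i2 [|i3 []]]] //= uI _ [_ _ b3] IP lI.
apply: (two_chains_single (S1 := [pred j | l j == i1]) (S2 := [pred j | l j == i2])
  (@label_rel_refl _ l m) (@label_rel_trans _ l m) (@label_key_inj _ m)).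
- exact: label_chain.
- exact: label_chain.
- move=> i /=; apply/negP => /andP[/eqP-> /eqP i12].
  by move: uI; rewrite i12 !inE eqxx.
have l3 i : ~~ ((l i == i1) || (l i == i2)) -> l i == i3.
  by move=> li; have := lI i; rewrite !inE orbA (negPf li).
move=> i j /l3 li /l3 lj; have := label_card lb IP (i := i3).
rewrite !inE eqxx !orbT => /(_ isT); rewrite b3 => card3.
have /card_le1_eqP : #|[pred j | l j == i3]| <= 1 by rewrite card3.
by apply; rewrite !inE.
Qed.

(** [R] is abstract because both [label_rel] and its converse occur, the latter for row spaces. *)
Lemma reducible01_dim2 n (R : rel 'I_n) (l k : 'I_n -> nat) (b : seq nat) :
  reflexive R -> transitive R -> injective k ->
  (forall i j, l i = l j -> k i <= k j -> R i j) ->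
  part_of b = [:: 2; 2; 2] -> labels b l -> reducible01 K 2 R.
Proof.
move=> Rr Rt kinj Rk; have [I [uI IE IP]] := part_of_support b; rewrite -IE => bE lb.
have lI := label_mem lb IP.
case: I uI IE bE IP lI => [|i1 [|i2 [|i3 []]]] //= uI _ [_ _ b3] IP lI.
have := label_card lb IP (i := i3).
rewrite !inE eqxx !orbT => /(_ isT); rewrite b3 => /(card2_sorted k)[x [y [xy kxy l3]]].
have lx : l x = i3 by have := l3 x; rewrite /= eqxx => /eqP.
have ly : l y = i3 by have := l3 y; rewrite /= eqxx orbT => /eqP.
have chR i : chain R k [pred j | l j == i].
  by move=> i' j' /= /eqP li /eqP lj; apply: Rk; rewrite li lj.
apply: (three_chains_dim2 (S1 := [pred j | l j == i1]) (S2 := [pred j | l j == i2])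
  Rr Rt (x := x) (y := y) kinj) => //.
- move=> i /=; apply/negP => /andP[/eqP-> /eqP i12].
  by move: uI; rewrite i12 !inE eqxx.
- move=> i /= li; have := lI i; rewrite !inE orbA (negPf li) /= => li3.
  by have := l3 i; rewrite /= li3 => /esym/orP[]/eqP->; [left|right].
- move: uI; rewrite /= ly !inE negb_or => /and3P[/andP[_ i13] i23 _].
  by rewrite !(eq_sym i3) negb_or i13.
by apply: Rk; rewrite ?lx ?ly.
Qed.

(** Let s and t be the two vectors in the part 2 of [c]. If they have the same [l], they form a
    whole fibre and are equivalent for the preorder: the tied case. Otherwise s is below t, which
    links the smallest element of the fibre of s to the largest of that of t. *)
Lemma reducible01_dim3 n (l m : 'I_n -> nat) (b c : seq nat) :
  part_of b = [:: 2; 2; 2] -> part_of c = [:: 2; 1; 1; 1; 1] ->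
  labels b l -> labels c m -> reducible01 K 3 (label_rel l m).
Proof.
have [I [uI IE IP]] := part_of_support b; rewrite -IE => bE.
have [J [uJ JE JP]] := part_of_support c; rewrite -JE => cE lb mc.
have lI := label_mem lb IP.
have Rr := @label_rel_refl _ l m; have Rt := @label_rel_trans _ l m.
have kinj := @label_key_inj _ m; have ch := @label_chain _ l m.
case: J uJ JE cE JP => [//|j0 J] /= _ _ [c0 _] JP.
have := label_card mc JP (mem_head _ _).
rewrite c0 => /(card2_sorted l)[s [t [st lst mE]]].
have mst : m s = m t.
  have /eqP -> : m s == j0 by have := mE s; rewrite /= eqxx.
  by have := mE t; rewrite /= eqxx orbT => /eqP.
case: I uI IE bE IP lI => [|i1 [|i2 [|i3 []]]] //= uI _ [b1 b2 b3] IP lI.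
have fib i : exists x y, [/\ x != y, label_key m x <= label_key m y &
    [pred j | l j == l i] =1 pred2 x y].
  apply: card2_sorted; rewrite (label_card lb IP) //.
  by have := lI i; rewrite !inE => /or3P[]/eqP->.
have third i j p q : l p <> l q -> l i <> l p -> l i <> l q -> l j <> l p ->
    l j <> l q -> l i = l j.
  have := (lI i, lI j, lI p, lI q); rewrite !inE => -[[[]]]; lia.
have [lE|ltlst] := eqVneq (l s) (l t).
  have [i [i' [ii' [li li' lE']]]] : exists i i', i != i' /\ [/\ i != l s, i' != l s &
      forall j, l j \in [:: l s; i; i']].
    move: uI lI; rewrite !inE negb_or => /and3P[/andP[i12 i13] i23 _] lI.
    have := lI s; rewrite !inE => /or3P[]/eqP ls.
    - by exists i2, i3; rewrite ls ![_ == i1]eq_sym; split.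
    - exists i1, i3; rewrite ls [i3 == _]eq_sym; split=> //; split=> // j.
      by have := lI j; rewrite !inE orbCA.
    - exists i1, i2; rewrite ls; split=> //; split=> // j.
      by have := lI j; rewrite !inE orbA orbC.
  have [x [y [xy _ sE]]] := fib s.
  have sx : pred2 x y s by rewrite -sE /=.
  have tx : pred2 x y t by rewrite -sE /= lE.
  apply: (tied_chains_dim3 (S1 := [pred j | l j == i]) (S2 := [pred j | l j == i'])
    Rr Rt (x := s) (y := t) kinj) => //.
  - by move=> j /=; apply/negP => /andP[/eqP-> ]; apply/negP.
  - move=> j /= lj; have := lE' j; rewrite !inE (negPf lj) orbF => lsj.
    have : pred2 x y j by rewrite -sE.
    move: sx tx st => /= /orP[]/eqP-> /orP[]/eqP->; rewrite ?eqxx // => _;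
      by case/orP=> /eqP->; auto.
  - by rewrite /= ![l s == _]eq_sym negb_or li.
  - by rewrite /= -lE ![l s == _]eq_sym negb_or li.
  - by rewrite /label_rel lE mst !leqnn.
  - by rewrite /label_rel lE mst !leqnn.
have [z [w [zw kzw sE]]] := fib s; have [x [y [xy kxy tE]]] := fib t.
have lz : l z = l s by have := sE z; rewrite /= eqxx => /eqP.
have lw : l w = l s by have := sE w; rewrite /= eqxx orbT => /eqP.
have lx : l x = l t by have := tE x; rewrite /= eqxx => /eqP.
have ly : l y = l t by have := tE y; rewrite /= eqxx orbT => /eqP.
have Rst : label_rel l m s t by rewrite /label_rel lst mst leqnn.
have Rzs : label_rel l m z s.
  have: pred2 z w s by rewrite -sE /=.
  by case/orP=> /eqP->; rewrite ?Rr //; apply: (ch (l s)); rewrite //= ?lz ?lw.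
have Rty : label_rel l m t y.
  have: pred2 x y t by rewrite -tE /=.
  by case/orP=> /eqP->; rewrite ?Rr //; apply: (ch (l t)); rewrite //= ?lx ?ly.
have ne u v : l u = l s -> l v = l t -> u != v.
  by move=> lu lv; apply: contraNneq ltlst => uv; rewrite -lu uv lv.
apply: (linked_chains_dim3 (S := [pred j | (l j != l s) && (l j != l t)])
  Rr Rt (k := label_key m) (z := z) (t := w) (x := x) (y := y)) => //.
- move=> i j /= /andP[is_ it_] /andP[js jt] /label_keyP mij.
  by rewrite /label_rel (third i j s t) ?leqnn //; apply/eqP.
- move=> i j iz jz; by apply: (ch (l s)); rewrite sE.
- move=> i j ix jx; by apply: (ch (l t)); rewrite tE.
- move=> i /=; rewrite negb_and !negbK => /orP[/eqP li|/eqP li].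
    have /orP[/eqP->|/eqP->] : pred2 z w i by rewrite -sE /= li.
      exact: Or41.
    exact: Or42.
  have /orP[/eqP->|/eqP->] : pred2 x y i by rewrite -tE /= li.
    exact: Or43.
  exact: Or44.
- move=> i /= /andP[ils ilt]; rewrite !inE; apply/negP.
  by case/or4P => /eqP iE; move: ils ilt; rewrite iE ?lz ?lw ?lx ?ly eqxx.
- by rewrite /= !inE !negb_or zw xy !ne.
- by apply: (ch (l t)); rewrite //= ?lx ?ly.
by apply: Rt (Rt _ _ _ Rst Rty); apply: Rzs.
Qed.

End FiniteTriples.

(** * Triples with Tits form 1 *)

Section Classification.

Lemma sqnorm_cons x s : sqnorm (x :: s) = x ^ 2 + sqnorm s.
Proof. by rewrite /sqnorm big_cons. Qed.

Lemma sqnorm_nil : sqnorm [::] = 0.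
Proof. exact: big_nil. Qed.

Lemma sqnorm_nseq k x : sqnorm (nseq k x) = k * x ^ 2.
Proof. by elim: k => [|k IHk]; rewrite ?sqnorm_nil //= sqnorm_cons IHk mulSn. Qed.

Lemma sqnorm_part_of a : sqnorm (part_of a) = sqnorm a.
Proof.
rewrite /sqnorm (perm_big _ (perm_part_of a)) big_filter big_mkcond.
by apply: eq_bigr => x _; case: eqVneq => [->|].
Qed.

Lemma sumn_le_sqnorm s : sumn s <= sqnorm s.
Proof. by elim: s => [|x s IHs] //=; rewrite sqnorm_cons; nia. Qed.

Lemma size_le_sumn s : 0 \notin s -> size s <= sumn s.
Proof. by elim: s => //= x s IHs; rewrite inE negb_or => /andP[x0 /IHs]; lia. Qed.

Lemma sqnorm_eq_sumn s : 0 \notin s -> sqnorm s <= sumn s -> s = nseq (sumn s) 1.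
Proof.
elim: s => //= x s IHs; rewrite sqnorm_cons inE negb_or => /andP[x0 /IHs sE] le.
have := sumn_le_sqnorm s => les; have x1 : x = 1 by nia.
by rewrite x1 /= -sE //; move: le; rewrite x1; lia.
Qed.

Lemma sumn_sqr_le s : sumn s ^ 2 <= size s * sqnorm s.
Proof.
elim: s => [|x s IHs] //=; rewrite sqnorm_cons.
have : 2 * x * sumn s <= size s * x ^ 2 + sqnorm s.
  elim: s {IHs} => [|y s IHs] /=; first by rewrite muln0.
  by rewrite sqnorm_cons mulnDr mulSn; have := (nat_Cauchy x y).1; lia.
by rewrite sqrnD mulSn mulnDr; lia.
Qed.

Lemma part_of_sorted a : sorted geq (part_of a).
Proof. by apply: sort_sorted => x y; rewrite /geq /= leq_total. Qed.

Lemma part_of_pos a : 0 \notin part_of a.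
Proof. by rewrite (perm_mem (perm_part_of a)) mem_filter eqxx. Qed.

(** Each pair contributes at least n^2 / 2, which leaves s <= 2. *)
Lemma squares_22 n x1 x2 y1 y2 s : x1 + x2 = n -> y1 + y2 = n -> n <= s ->
  x1 ^ 2 + x2 ^ 2 + (y1 ^ 2 + y2 ^ 2) + s = n ^ 2 + 2 -> n <= 2.
Proof.
move=> sx sy sn Q; have := (nat_Cauchy x1 x2).1; have := (nat_Cauchy y1 y2).1.
by have := sqrnD x1 x2; have := sqrnD y1 y2; rewrite sx sy; lia.
Qed.

(** In the differences d = x1 - x2 and e = y1 - y2 the equation reads d^2 + e^2 + 2 s = 2 n + 1, and
    s >= n leaves d^2 + e^2 = 1. *)
Lemma squares_near n x1 x2 y1 y2 s : x2 <= x1 -> y2 <= y1 ->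
    x1 + x2 = n -> y1 + y2 + 1 = n -> n <= s ->
    x1 ^ 2 + x2 ^ 2 + (y1 ^ 2 + y2 ^ 2 + 1) + s = n ^ 2 + 2 ->
  s = n /\ (x1 = x2 /\ y1 = y2.+1 \/ x1 = x2.+1 /\ y1 = y2).
Proof.
move=> x21 y21 sx sy sn Q.
have [d xE] : exists d, x1 = x2 + d by exists (x1 - x2); lia.
have [e yE] : exists e, y1 = y2 + e by exists (y1 - y2); lia.
have H : d ^ 2 + e ^ 2 + 2 * s = 2 * n + 1.
  have := sqrnD (y1 + y2) 1; rewrite sy => nn.
  by subst x1 y1; rewrite -sx in Q nn *; nia.
have dd : d <= d ^ 2 by case: (d) => // d'; rewrite leq_pmulr.
have ee : e <= e ^ 2 by case: (e) => // e'; rewrite leq_pmulr.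
have [[dE|dE] [eE|eE]] : (d = 0 \/ d = 1) /\ (e = 0 \/ e = 1) by lia.
all: by move: H; rewrite xE yE dE eE; lia.
Qed.

Lemma squares_y y1 y2 y3 n : y1 + (y2 + y3) = n ->
  n ^ 2 <= 3 * (y1 ^ 2 + (y2 ^ 2 + y3 ^ 2)).
Proof.
move=> sy; have := (nat_Cauchy y1 y2).1; have := (nat_Cauchy y1 y3).1.
have := (nat_Cauchy y2 y3).1; have := sqrnD y1 (y2 + y3); have := sqrnD y2 y3.
by rewrite sy; nia.
Qed.

(** The equation gives (n - 3)(n - 6) <= 0, while three parts at least 2 need n >= 6. *)
Lemma squares_24 n x1 y1 y2 y3 s : 2 <= x1 -> y2 <= y1 -> y3 <= y2 -> 1 < y3 ->
    x1 + 2 = n -> y1 + (y2 + y3) = n -> n <= s ->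
    x1 ^ 2 + 2 ^ 2 + (y1 ^ 2 + (y2 ^ 2 + y3 ^ 2)) + s = n ^ 2 + 2 ->
  [/\ x1 = 4, y1 = 2, y2 = 2, y3 = 2 & s = 6].
Proof.
move=> x2 y21 y32 y3_1 sx sy sn Q.
have n6 : n <= 6.
  by have := squares_y sy; have := sqrnD x1 2; rewrite sx; nia.
have y1E : y1 = 2 by lia.
have y2E : y2 = 2 by lia.
have y3E : y3 = 2 by lia.
subst y1 y2 y3; have x1E : x1 = 4 by lia.
by subst x1; split; lia.
Qed.

(** As 1/2 + 1/3 + 1/5 = 31/30, the equation gives n^2 <= 60, so n is 6 or 7; for n = 7 it forces s
    = 9, but 49 > 5 * 9. *)
Lemma squares_33 n x1 x2 y1 y2 y3 s : x2 <= x1 -> 2 < x2 ->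
    y2 <= y1 -> y3 <= y2 -> 1 < y3 ->
    x1 + x2 = n -> y1 + (y2 + y3) = n -> n ^ 2 <= 5 * s ->
    x1 ^ 2 + x2 ^ 2 + (y1 ^ 2 + (y2 ^ 2 + y3 ^ 2)) + s = n ^ 2 + 2 ->
  [/\ x1 = 3, x2 = 3, y1 = 2, y2 = 2 & y3 = 2 /\ s = 8].
Proof.
move=> x21 x2_2 y21 y32 y3_1 sx sy Q0 Q.
have n7 : n <= 7.
  have := squares_y sy; have := sqrnD x1 x2; have := (nat_Cauchy x1 x2).1.
  rewrite sx => xx xn yn; have {xx xn yn} : n ^ 2 <= 60 by lia.
  by rewrite leqNgt [n <= 7]leqNgt; apply: contra => n8; rewrite (leq_trans _ (leq_mul n8 n8)).
have x2E : x2 = 3 by lia.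
have y3E : y3 = 2 by lia.
have y2E : y2 = 2 by lia.
subst x2 y3 y2; have [x1E|x1E] : x1 = 3 \/ x1 = 4 by lia.
  have nE : n = 6 by lia.
  have y1E : y1 = 2 by lia.
  by move: Q; rewrite nE y1E x1E => Q; split=> //; split=> //; lia.
have nE : n = 7 by lia.
have y1E : y1 = 3 by lia.
by move: Q0 Q; rewrite nE y1E x1E; lia.
Qed.

(** One ordering of each triple, by weakly increasing number of parts. *)
Definition listed (x y z : seq nat) :=
  [\/ [:: x; y; z] = [:: [:: 1]; [:: 1]; [:: 1]],
      [:: x; y; z] = [:: nseq 2 3; nseq 3 2; [:: 2; 1; 1; 1; 1]],
      [:: x; y; z] = [:: [:: 4; 2]; nseq 3 2; nseq 6 1] |
  [\/ exists2 m, 2 <= m &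
        [:: x; y; z] = [:: [:: m.+1; m]; [:: m; m; 1]; nseq (2 * m).+1 1],
      exists2 m, 2 <= m &
        [:: x; y; z] = [:: [:: m; m]; [:: m; m.-1; 1]; nseq (2 * m) 1] |
      exists2 n, 2 <= n &
        [:: x; y; z] = [:: [:: n.-1; 1]; nseq n 1; nseq n 1]]].

(** Excluding E6, E7 and E8 bounds the numbers of parts in turn: x has at most 2, y at most 3 once
    the smaller part of x is at least 2, z at most 5 once that part is at least 3 and y has three
    parts at least 2. *)
Lemma classification n x y z :
    size x <= size y <= size z ->
    sorted geq x -> sorted geq y -> sorted geq z ->
    0 \notin x -> 0 \notin y -> 0 \notin z ->
    sumn x = n -> sumn y = n -> sumn z = n ->
    sqnorm x + sqnorm y + sqnorm z = n ^ 2 + 2 ->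
    size x <= 2 ->
    ~ [/\ 2 <= count (leq 2) x, 4 <= size y & 4 <= size z] ->
    ~ [/\ 2 <= count (leq 3) x, 3 <= count (leq 2) y & 6 <= size z] ->
  listed x y z.
Proof.
move=> /andP[sxy syz] ox oy oz px py pz sx sy sz Q s2 h7 h8.
have zn := sumn_le_sqnorm z; have yn := sumn_le_sqnorm y.
case: x => [|x1 [|x2 []]] // in sxy ox px sx Q s2 h7 h8 *.
- have yE : y = [::] by apply: size0nil; have := size_le_sumn py; rewrite sy -sx leqn0 => /eqP.
  have zE : z = [::] by apply: size0nil; have := size_le_sumn pz; rewrite sz -sx leqn0 => /eqP.
  by move: Q; rewrite yE zE !sqnorm_nil -sx.
- move: sx Q px; rewrite /= addn0 !inE !sqnorm_cons sqnorm_nil => sx Q x1_0.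
  have x1E : x1 = 1 by rewrite sx in Q; lia.
  have nE : n = 1 by rewrite -sx.
  rewrite nE in sy sz; rewrite sy in yn; rewrite sz in zn; rewrite nE x1E in Q *.
  have -> : y = [:: 1] by rewrite (sqnorm_eq_sumn py) sy //; lia.
  have -> : z = [:: 1] by rewrite (sqnorm_eq_sumn pz) sz //; lia.
  exact: Or41.
move: sx Q px ox h7 h8; rewrite /= addn0 !inE !sqnorm_cons sqnorm_nil !andbT.
rewrite negb_or /geq /= => sx Q /andP[x1_0 x2_0] ox h7 h8.
(* For x = (n - 1, 1) the equation leaves 2 n for the squares of y and z, each at least n, so all
   their parts are 1. *)
have [x2_1|x2_2] := leqP x2 1.
  have {x2_1} x2E : x2 = 1 by lia.
  have nn : n ^ 2 = x1 ^ 2 + 1 + 2 * x1 by rewrite -sx x2E sqrnD muln1.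
  rewrite x2E in sx Q *; apply: Or44; apply: Or33; exists n; first by lia.
  rewrite sy in yn; rewrite sz in zn.
  have -> : y = nseq n 1 by rewrite (sqnorm_eq_sumn py) sy //; lia.
  have -> : z = nseq n 1 by rewrite (sqnorm_eq_sumn pz) sz //; lia.
  by congr [:: [:: _; _]; _; _]; lia.
have sy3 : size y <= 3.
  by rewrite leqNgt; apply/negP => y4; apply: h7; split; lia.
rewrite sz in zn.
case: y => [|y1 [|y2 [|y3 []]]] // in sxy syz oy py sy Q sy3 h7 h8 yn *.
  move: sy Q; rewrite /= addn0 !sqnorm_cons sqnorm_nil !addn0 => sy Q.
  by have := squares_22 sx sy zn Q; lia.
move: sy Q py oy h8; rewrite /= !inE !sqnorm_cons sqnorm_nil !addn0 !andbT.
rewrite !negb_or /geq /= => sy Q /and3P[y1_0 y2_0 y3_0] /andP[oy12 oy23] h8.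
have [y3_1|y3_2] := leqP y3 1.
  have {y3_1} y3E : y3 = 1 by lia.
  rewrite y3E in sy Q *.
  have sy' : y1 + y2 + 1 = n by lia.
  have Q' : x1 ^ 2 + x2 ^ 2 + (y1 ^ 2 + y2 ^ 2 + 1) + sqnorm z = n ^ 2 + 2 by lia.
  have [zE dE] := squares_near ox oy12 sx sy' zn Q'.
  have -> : z = nseq n 1 by rewrite (sqnorm_eq_sumn pz) sz // zE.
  apply: Or44.
  case: dE => -[xE yE]; [apply: Or32|apply: Or31]; exists x2; try lia;
    by congr [:: [:: _; _]; [:: _; _; _]; nseq _ _]; lia.
have [x2_3|x2_3] := leqP x2 2.
  have x2E : x2 = 2 by lia.
  rewrite x2E in sx Q ox *.
  have [xE y1E y2E y3E zE] := squares_24 ox oy12 oy23 y3_2 sx sy zn Q.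
  have nE : n = 6 by rewrite -sx xE.
  have -> : z = nseq n 1 by rewrite (sqnorm_eq_sumn pz) sz // zE nE.
  by apply: Or43; rewrite nE xE y1E y2E y3E.
have z5 : size z <= 5.
  by rewrite leqNgt; apply/negP => z6; apply: h8; split; lia.
have cs : n ^ 2 <= 5 * sqnorm z.
  by rewrite -sz (leq_trans (sumn_sqr_le z)) // leq_mul2r z5 orbT.
have [xE x2E y1E y2E [y3E zE]] := squares_33 ox x2_3 oy12 oy23 y3_2 sx sy cs Q.
have nE : n = 6 by rewrite -sx xE x2E.
apply: Or42; rewrite xE x2E y1E y2E y3E; congr [:: _; _; _].
(* From 36 <= 8 * [size z], z has exactly five parts, with sum 6. *)
rewrite nE in sz; have := sumn_sqr_le z; rewrite zE sz => z8.
have {z8} : size z = 5 by lia.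
move: sz oz pz; case: z {syz h7 h8 Q zE cs z5 zn} =>
  [|z1 [|z2 [|z3 [|z4 [|z5 []]]]]] //= + + + _.
rewrite !inE !negb_or /geq /= addn0 => sz oz pz.
congr [:: _; _; _; _; _]; lia.
Qed.

End Classification.

(** * Symmetry in the three flags and the final equivalence *)

Section FiniteType.

Lemma perm3_ind (T : eqType) (P : T -> T -> T -> Prop) x y z x' y' z' :
    (forall u v w, P u v w -> P v u w) -> (forall u v w, P u v w -> P u w v) ->
  perm_eq [:: x; y; z] [:: x'; y'; z'] -> P x' y' z' -> P x y z.
Proof.
move=> P12 P23 pe Pxyz.
have perm2 (u v u' v' : T) : perm_eq [:: u; v] [:: u'; v'] ->
    u = u' /\ v = v' \/ u = v' /\ v = u'.
  move=> puv; have := perm_mem puv u; rewrite !inE eqxx => /esym/orP[]/eqP uE.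
    by move: puv; rewrite uE perm_cons => /perm_consP[[|i] [s [/= [<-] _]]] //; left.
  move: puv; rewrite perm_sym (perm_catC [:: u'] [:: v']) uE perm_cons.
  by move=> /perm_mem/(_ v); rewrite !inE eqxx => /eqP; right.
have := perm_mem pe x; rewrite !inE eqxx => /esym/or3P[]/eqP xE; move: pe.
- by rewrite xE perm_cons => /perm2[[-> ->]|[-> ->]] //; apply/P23.
- rewrite xE perm_sym (perm_catCA [:: x'] [:: y'] [:: z']) perm_cons perm_sym.
  by move=> /perm2[[-> ->]|[-> ->]]; [|apply/P23]; apply/P12.
rewrite xE perm_sym (perm_catCA [:: x'; y'] [:: z'] [::]) cats0 perm_cons perm_sym.
by move=> /perm2[[-> ->]|[-> ->]]; [|apply/P23]; apply/P12; apply/P23.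
Qed.

Lemma count_part_of k a : 0 < k -> count (leq k) (part_of a) = count (leq k) a.
Proof.
move=> k0; rewrite (permP (perm_part_of a)) count_filter; apply: eq_count => x /=.
by case: x => [|x]; rewrite ?andbT ?andbF // leqNgt k0.
Qed.

Lemma size_part_of a : size (part_of a) = count (leq 1) a.
Proof.
have pa := perm_part_of a; rewrite -count_part_of // (perm_size pa) (permP pa).
by rewrite count_filter size_filter; apply: eq_count => -[].
Qed.

Variable K : closedFieldType.

(** Existential in the lengths too, so that it is symmetric in the three partitions and [perm3_ind]
    applies. *)
Definition finite_parts n x y z := exists p q r (a : p.-tuple nat)
  (b : q.-tuple nat) (c : r.-tuple nat),
  [/\ sumn a = n, sumn b = n & sumn c = n] /\
  [/\ part_of a = x, part_of b = y, part_of c = z & finite_orbits K n a b c].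

Lemma finite_parts_classification n x y z : finite_parts n x y z ->
    size x <= size y <= size z -> sqnorm x + sqnorm y + sqnorm z = n ^ 2 + 2 ->
  listed x y z.
Proof.
move=> [p [q [r [a [b [c [[sa sb sc] [<- <- <- fin]]]]]]]] le Q.
apply: (classification le _ _ _ _ _ _ _ _ _ Q);
  rewrite ?sumn_part_of ?part_of_pos ?part_of_sorted //.
- have /andP[xy yz] := le; rewrite leqNgt; apply/negP => x3.
  apply: (infinite_E6 sa sb sc) fin; rewrite -size_part_of //.
    exact: leq_trans xy.
  exact: leq_trans (leq_trans x3 xy) yz.
- case=> x2 y4 z4; apply: (infinite_E7 sa sb sc) fin; rewrite -?size_part_of //.
  by rewrite -count_part_of.
case=> x2 y4 z4; apply: (infinite_E8 sa sb sc) fin; rewrite -?size_part_of //;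
  by rewrite -count_part_of.
Qed.

Lemma listed_finite n p q r (a : p.-tuple nat) (b : q.-tuple nat)
    (c : r.-tuple nat) : sumn a = n -> sumn b = n -> sumn c = n ->
  listed (part_of a) (part_of b) (part_of c) -> finite_orbits K n a b c.
Proof.
move=> sa sb sc.
have two x y : part_of a = [:: x; y] -> n = x + y /\
    exists2 u, u = x \/ u = y &
      forall i, i <= p -> sumn (take i a) \in [:: 0; u; n].
  move=> aE; have nE : n = x + y by rewrite -sa -sumn_part_of aE /= addn0.
  split=> //; have [u uxy uE] := two_parts aE; exists u => // i _.
  by rewrite nE.
(* Either value of u will do: the number of columns is irrelevant when the third part is 1. *)
have single x y x' y' : part_of a = [:: x; y] -> part_of b = [:: x'; y'; 1] ->
    finite_orbits K n a b c.
  move=> aE bE; have [nE [u uxy au]] := two _ _ aE.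
  apply: (finite_orbits_ker (u := u)) => //; first by lia.
  by move=> l m lb _; apply: reducible01_single bE lb.
case; [move=> [aE bE cE]|move=> [aE bE cE]|move=> [aE bE cE]|case].
- have nE : n = 1 by rewrite -sa -sumn_part_of aE.
  apply: (finite_orbits_ker (u := 0)) => // [i _|l m _ _].
    by have := one_part aE i; rewrite nE !inE orbA orbb.
  have -> : n - 0 = 1 by rewrite nE.
  exact/dim1_reducible01/label_rel_refl.
- have [nE [u uxy au]] := two _ _ aE.
  apply: (finite_orbits_ker (u := u)) => //; first by lia.
  have -> : n - u = 3 by lia.
  by move=> l m lb mc; apply: reducible01_dim3 bE cE lb mc.
- have [nE [u uxy au]] := two _ _ aE.
  (* Kernel or row space, whichever has two columns. *)
  have [u4|u2] := uxy.
    apply: (finite_orbits_ker (u := u)) => //; first by lia.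
    have -> : n - u = 2 by lia.
    move=> l m lb _; apply: (reducible01_dim2 (k := label_key m)) bE lb.
    - exact: label_rel_refl.
    - exact: label_rel_trans.
    - exact: label_key_inj.
    - by move=> i j lij /label_keyP mij; rewrite /label_rel lij mij leqnn.
  apply: (finite_orbits_span (u := u)) => //; first by lia.
  rewrite u2 => l m lb _; pose L := \max_i label_key m i.
  have kL i : label_key m i <= L by apply: leq_bigmax.
  (* The relation is reversed here, hence also the key. *)
  apply: (reducible01_dim2 (k := fun i => L - label_key m i)) bE lb.
  - exact: label_rel_refl.
  - by move=> j i k Rji Rkj; apply: label_rel_trans Rkj Rji.
  - by move=> i j kij; apply: (@label_key_inj n m); have := kL i; have := kL j; lia.
  - move=> i j lij kij; have /label_keyP mji : label_key m j <= label_key m i.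
      by have := kL i; have := kL j; lia.
    by rewrite /label_rel lij mji leqnn.
- by case=> m _ [aE bE cE]; apply: single aE bE.
- by case=> m _ [aE bE cE]; apply: single aE bE.
case=> k k2 [aE bE cE]; have [nE [u uxy au]] := two _ _ aE.
have [u1|u1] := uxy.
  apply: (finite_orbits_ker (u := u)) => //; first by lia.
  have -> : n - u = 1 by lia.
  move=> l m _ _; exact/dim1_reducible01/label_rel_refl.
apply: (finite_orbits_span (u := u)) => //; first by lia.
rewrite u1 => l m _ _; apply: dim1_reducible01 => i; apply: label_rel_refl.
Qed.

Lemma listed_sqnorm x y z : listed x y z ->
  sqnorm x + sqnorm y + sqnorm z = sumn x ^ 2 + 2.
Proof.
case=> [[-> -> ->]|[-> -> ->]|[-> -> ->]|]; rewrite ?sqnorm_nseq ?sqnorm_cons ?sqnorm_nil //.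
by case=> [[m m2 [-> -> ->]]|[m m2 [-> -> ->]]|[n n2 [-> -> ->]]];
  rewrite !sqnorm_cons sqnorm_nil !sqnorm_nseq /=;
  [|case: m m2 => // m _|case: n n2 => // n _];
  rewrite /= -!mulnn; lia.
Qed.

Lemma tits_form1 p q r (a : p.-tuple nat) (b : q.-tuple nat) (c : r.-tuple nat) :
  tits_form (a, b, c) = 1%R <-> sqnorm a + sqnorm b + sqnorm c = sumn a ^ 2 + 2.
Proof.
rewrite /tits_form /=; set A := sqnorm a; set B := sqnorm b; set C := sqnorm c.
have E : ((A%:R + B%:R + C%:R - (sumn a)%:R ^+ 2) / 2%:R == 1 :> rat)%R =
    (A + B + C == sumn a ^ 2 + 2).
  rewrite -(inj_eq (mulIf (_ : 2%:R != 0 :> rat)%R)) // mulfVK // mul1r.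
  by rewrite subr_eq -natrX -!natrD Num.Theory.eqr_nat [(2 + _)%N]addnC.
by split=> /eqP; [rewrite E|rewrite -E] => /eqP.
Qed.

Lemma listed_permP s : (exists x y z, listed x y z /\ perm_eq s [:: x; y; z]) <->
    [\/ perm_eq s [:: [:: 1]; [:: 1]; [:: 1]],
        perm_eq s [:: nseq 2 3; nseq 3 2; [:: 2; 1; 1; 1; 1]],
        perm_eq s [:: [:: 4; 2]; nseq 3 2; nseq 6 1] |
    [\/ exists2 m, 2 <= m &
          perm_eq s [:: [:: m.+1; m]; [:: m; m; 1]; nseq (2 * m).+1 1],
        exists2 m, 2 <= m &
          perm_eq s [:: [:: m; m]; [:: m; m.-1; 1]; nseq (2 * m) 1] |
        exists2 n, 2 <= n &
          perm_eq s [:: [:: n.-1; 1]; nseq n 1; nseq n 1]]].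
Proof.
split=> [[x [y [z [[->|->|->|[[m m2 ->]|[m m2 ->]|[m m2 ->]]] ps]]]]|].
- exact: Or41.
- exact: Or42.
- exact: Or43.
- by apply: Or44; apply: Or31; exists m.
- by apply: Or44; apply: Or32; exists m.
- by apply: Or44; apply: Or33; exists m.
case=> [ps|ps|ps|[[m m2 ps]|[m m2 ps]|[m m2 ps]]]; do 3!eexists; split; try exact: ps.
- exact: Or41.
- exact: Or42.
- exact: Or43.
- by apply: Or44; apply: Or31; exists m.
- by apply: Or44; apply: Or32; exists m.
- by apply: Or44; apply: Or33; exists m.
Qed.

End FiniteType.

Theorem theorem2p4 (K : closedFieldType) (p q r : nat)
    (hp : 0 < p) (hq : 0 < q) (hr : 0 < r)
    (a : p.-tuple nat) (b : q.-tuple nat) (c : r.-tuple nat)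
    (habc : Lambda (a, b, c)) :
  let abc := [:: part_of a; part_of b; part_of c] in
  Pi K (a, b, c) <->
    [\/ perm_eq abc [:: [:: 1]; [:: 1]; [:: 1]],
        perm_eq abc [:: nseq 2 3; nseq 3 2; [:: 2; 1; 1; 1; 1]],
        perm_eq abc [:: [:: 4; 2]; nseq 3 2; nseq 6 1] |
    [\/ exists2 m, 2 <= m &
          perm_eq abc [:: [:: m.+1; m]; [:: m; m; 1]; nseq (2 * m).+1 1],
        exists2 m, 2 <= m &
          perm_eq abc [:: [:: m; m]; [:: m; m.-1; 1]; nseq (2 * m) 1] |
        exists2 n, 2 <= n &
          perm_eq abc [:: [:: n.-1; 1]; nseq n 1; nseq n 1]]].
Proof.
move=> abc; rewrite -(listed_permP abc).
have [/= /esym sb sbc] := habc; have sc : sumn c = sumn a by rewrite -sbc.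
have sq x y z : perm_eq abc [:: x; y; z] -> sqnorm x + sqnorm y + sqnorm z =
    sqnorm a + sqnorm b + sqnorm c.
  move=> pxyz; have : \sum_(u <- abc) sqnorm u = \sum_(u <- [:: x; y; z]) sqnorm u.
    exact: perm_big.
  by rewrite !big_cons !big_nil !sqnorm_part_of !addn0 !addnA => <-.
split=> [[_ fin /tits_form1 Q]|[x [y [z [xyz pxyz]]]]].
  (* Sorting by number of parts gives the order assumed in [classification]. *)
  have := perm_sort (relpre size leq) abc.
  have : sorted (relpre size leq) (sort (relpre size leq) abc).
    by apply: sort_sorted => u v; apply: leq_total.
  have := size_sort (relpre size leq) abc.
  case: (sort _ _) => [|x [|y [|z []]]] //= _ /and3P[xy yz _] pxyz.
  have {}pxyz : perm_eq [:: x; y; z] abc by rewrite pxyz.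
  exists x, y, z; split; last by rewrite perm_sym.
  apply: (finite_parts_classification (K := K) (n := sumn a)); rewrite ?xy //.
    apply: perm3_ind pxyz _ => [u v w|u v w|].
    - move=> [p' [q' [r' [a' [b' [c' [[? ? ?] [? ? ? fin']]]]]]]].
      by exists q', p', r', b', a', c'; do 2!split=> //; apply: finite_orbitsC12.
    - move=> [p' [q' [r' [a' [b' [c' [[? ? ?] [? ? ? fin']]]]]]]].
      by exists p', r', q', a', c', b'; do 2!split=> //; apply: finite_orbitsC23.
    - by exists p, q, r, a, b, c.
  by rewrite sq // perm_sym.
have sx : sumn x = sumn a.
  have : x \in abc by rewrite (perm_mem pxyz) mem_head.
  by rewrite !inE => /or3P[]/eqP->; rewrite sumn_part_of.
split; [exact: habc| |by apply/tits_form1; rewrite -(sq x y z) // listed_sqnorm // sx].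
(* Transpositions permute the lengths along with the partitions, so [P] quantifies over all
   compositions with the given parts. *)
pose P x y z := forall p q r (a' : p.-tuple nat) (b' : q.-tuple nat) (c' : r.-tuple nat),
  sumn a' = sumn a -> sumn b' = sumn a -> sumn c' = sumn a ->
  part_of a' = x -> part_of b' = y -> part_of c' = z ->
  finite_orbits K (sumn a) a' b' c'.
suff: P (part_of a) (part_of b) (part_of c) by apply.
apply: perm3_ind pxyz _ => [u v w Puvw|u v w Puvw|].
- move=> p' q' r' a' b' c' sa' sb' sc' aE bE cE.
  by apply: finite_orbitsC12; apply: Puvw.
- move=> p' q' r' a' b' c' sa' sb' sc' aE bE cE.
  by apply: finite_orbitsC23; apply: Puvw.
move=> p' q' r' a' b' c' sa' sb' sc' aE bE cE.
by apply: listed_finite; rewrite // aE bE cE.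
Qed.
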